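(* Suppose that $f,g$ are twice continuously differentiable and that $-f(x,\cdot)$ and $g_i(x,\cdot)$, $i=1,\dots,q$, are convex for all $x$ near $\bar x$. Let $\bar y\in\mathcal S(\bar x)$ and $\bar\lambda\in\Sigma(\bar x,\bar y)$. Suppose that a CQ holds at $(\bar x,\bar y,\bar\lambda)$ for the constraint system in $(x,y,\lambda)$ $$(\ast)\qquad \nabla_y\mathcal L(x,y,\lambda)=0,\quad\lambda\ge0 .$$ Then $$\widehat\partial V(\bar x)\subseteq\{\nabla_x\mathcal L(\bar x,\bar y,\bar\lambda)+\nabla_{xy}^2\mathcal L(\bar x,\bar y,\bar\lambda)u:\ u\in\Xi^1(\bar x,\bar y,\bar\lambda)\}.$$ Suppose moreover that the restricted sup-compactness holds at $\bar x$, that a stable parametric CQ holds for $(P_{\bar x})$ at all $y\in\mathcal S(\bar x)$, and that a stable CQ holds for the system $(\ast)$ at all $(\bar x,\tilde y,\tilde\lambda)$ with $\tilde y\in\mathcal S(\bar x)$ and $\tilde\lambda\in\Sigma(\bar x,\tilde y)$. Then $$\partial V(\bar x)\subseteq\bigcup_{y\in\mathcal S(\bar x)}\{\nabla_x\mathcal L(\bar x,y,\lambda)+\nabla_{xy}^2\mathcal L(\bar x,y,\lambda)u:\ u\in\Xi^1(\bar x,y,\lambda),\ \lambda\in\Sigma(\bar x,y)\},$$ $$\partial^\infty V(\bar x)\subseteq\bigcup_{y\in\mathcal S(\bar x)}\{\nabla_{xy}^2\mathcal L(\bar x,y,\lambda)u:\ u\in\Xi^0(\bar x,y,\lambda),\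 \lambda\in\Sigma(\bar x,y)\}.$$
   Context: Setting. $f:\mathbb R^{n+m}\to\mathbb R$, $g:\mathbb R^{n+m}\to\mathbb R^q$. For $x\in\mathbb R^n$, $(P_x)$ is the problem $\max_y f(x,y)$ s.t. $y\in\mathcal F(x)=\{y\in\mathbb R^m:g(x,y)\le0\}$; $V(x)=\sup\{f(x,y):y\in\mathcal F(x)\}$ ($=-\infty$ if $\mathcal F(x)=\emptyset$); $\mathcal S(x)=\{y\in\mathcal F(x):f(x,y)=V(x)\}$. For a vector-valued map, $\nabla$ is the transposed Jacobian. $\mathcal L(x,y,\lambda)=f(x,y)-g(x,y)^\top\lambda$; $\nabla^2_{xy}\mathcal L\in\mathbb R^{n\times m}$, with $\nabla_{xy}^2\mathcal L\,u=\nabla_x(u^\top\nabla_y\mathcal L)$. $\Sigma(x,y)=\{\lambda:\nabla_y\mathcal L(x,y,\lambda)=0,\ 0\le-g(x,y)\perp\lambda\ge0\}$. For $r\in\{0,1\}$, $$\Xi^r(x,y,\lambda)=\{u\in\mathbb R^m:\nabla^2_{yy}\mathcal L(x,y,\lambda)u=0,\ 0\le-\nabla_yg(x,y)^\top u-r\,g(x,y)\perp\lambda\ge0\}.$$ Restricted sup-compactness at $\bar x$: $V(\bar x)$ is finite and there are $\epsilon,\delta>0$ and a compact set $\Omega$ such that $\mathcal S(x)\cap\Omega\ne\emptyset$ for all $x$ with $\|x-\bar x\|<\delta$ and $V(x)>V(\bar x)-\epsilon$. Subdifferentials. For $\varphi:\mathbb R^n\to[-\infty,\infty]$ finite at $x^*$: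 $\widehat\partial\varphi(x^* )=\{w:\varphi(x)\ge\varphi(x^* )+w^\top(x-x^* )+o(\|x-x^*\|)\}$; $\partial\varphi(x^* )$ is the set of limits of $w^k\in\widehat\partial\varphi(x^k)$ with $x^k\to x^*$, $\varphi(x^k)\to\varphi(x^* )$; $\partial^\infty\varphi(x^* )$ is the set of limits of $t_kw^k$ with such $x^k,w^k$ and $t_k\downarrow0$. CQs. Consider a system $G(p,z)\le0$, $H(p,z)=0$ in the variable $z$ with parameter $p$ ($G,H$ continuously differentiable), with feasible set $Z(p)$, and put $$\mathcal M(\beta,p,z)=\{(a,b):\beta-\nabla_zG(p,z)a-\nabla_zH(p,z)b=0,\ 0\le a\perp-G(p,z)\ge0,\ H(p,z)=0\}.$$ A CQ at $\bar z\in Z(\bar p)$ is a condition on the system ensuring that whenever $\bar z$ is a local maximizer over $Z(\bar p)$ of a continuously differentiable function $\varphi$, one has $\mathcal M(\nabla\varphi(\bar z),\bar p,\bar z)\neq\emptyset$ (equivalently, that KKT holds at $\bar z$ for every continuously differentiable objective minimized locally at $\bar z$). A condition that may hold or fail at points $(p,z)$ with $z\in Z(p)$ is called a stable parametric CQ if, whenever it holds at $\bar z\in Z(\bar p)$: it is locally persistent, i.e. it holds at every $z\in Z(p)$ with $(p,z)$ in some neighborhood of $(\bar p,\bar z)$; (i) it is a CQ at $\bar z\in Z(\bar p)$; (ii) for all sequences $\beta^k\to\bar\beta$, $z^k\to\bar z$, $p^k\to\bar p$ with $\mathcal M(\beta^k,p^k,z^k)\ne\emptyset$ for all $k$, there exist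 $(a^k,b^k)\in\mathcal M(\beta^k,p^k,z^k)$ converging along a subsequence to some $(\bar a,\bar b)\in\mathcal M(\bar\beta,\bar p,\bar z)$. A stable CQ is the same notion for a system without parameter (all dependence on $p$ omitted). A stable parametric CQ for $(P_{\bar x})$ at $y$ refers to the system $g(x,y)\le0$ with variable $y$ and parameter $x$ at $\bar x$. *)

(* Defs.v *)
From HB Require Import structures.
From mathcomp Require Import all_boot all_order all_algebra.
From mathcomp Require Import all_classical all_reals all_analysis.

Set Implicit Arguments.
Unset Strict Implicit.
Unset Printing Implicit Defensive.

Import Order.TTheory GRing.Theory Num.Theory.
Import numFieldNormedType.Exports.

Local Open Scope classical_set_scope.
Local Open Scope ring_scope.

(* Vectors of R^d are row vectors 'rV[R]_d.  For h : 'rV_d -> 'rV_k, the library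
   matrix 'J h z : 'M_(d, k) has entries d h_j / d z_i, i.e. it is the transposed
   Jacobian usually written nabla h(z).  Hence, on row vectors,
     nabla h(z) a    is  a *m ('J h z)^T      (a in R^k),
     nabla h(z)^T u  is  u *m 'J h z          (u in R^d).
   `|x| is the sup norm; it only occurs in notions that are the same for all
   norms of R^d. *)

Section Calculus.
Context {R : realType}.

Definition dot d (u v : 'rV[R]_d) : R := \sum_i u 0 i * v 0 i.

Definition grad d (phi : 'rV[R]_d -> R) (z : 'rV[R]_d) : 'rV[R]_d :=
  \row_i 'D_(delta_mx 0 i) phi z.

Definition C1 d (phi : 'rV[R]_d -> R) : Prop :=
  (forall z, differentiable phi z) /\ continuous (grad phi).

Definition C2 d (phi : 'rV[R]_d -> R) : Prop :=
  C1 phi /\ forall i, C1 (fun z => grad phi z 0 i).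

(* 0 <= a _|_ b >= 0 *)
Definition complementary d (a b : 'rV[R]_d) : Prop :=
  [/\ forall i, 0 <= a 0 i, forall i, 0 <= b 0 i & dot a b = 0].

End Calculus.

Section Subdifferentials.
Context {R : realType} {n : nat}.
Implicit Types (phi : 'rV[R]_n -> \bar R) (xs : 'rV[R]_n).

Definition regular_subdiff phi xs : set 'rV[R]_n :=
  [set w | phi xs \is a fin_num /\
     forall e : R, 0 < e -> \forall x \near xs,
       (phi xs + (dot w (x - xs) - e * `|x - xs|)%:E <= phi x)%E].

Definition limiting_subdiff phi xs : set 'rV[R]_n :=
  [set v | phi xs \is a fin_num /\
     exists (x w : nat -> 'rV[R]_n),
     [/\ x k @[k --> \oo] --> xs,
         phi (x k) @[k --> \oo] --> phi xs,
         forall k, regular_subdiff phi (x k) (w k) &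
         w k @[k --> \oo] --> v]].

Definition singular_subdiff phi xs : set 'rV[R]_n :=
  [set v | phi xs \is a fin_num /\
     exists (x w : nat -> 'rV[R]_n) (t : nat -> R),
     [/\ x k @[k --> \oo] --> xs,
         phi (x k) @[k --> \oo] --> phi xs,
         forall k, regular_subdiff phi (x k) (w k),
         (forall k, 0 < t k) /\ t k @[k --> \oo] --> 0 &
         t k *: w k @[k --> \oo] --> v]].

End Subdifferentials.

Section ConstraintQualifications.
Context {R : realType}.

Section Parametric.
(* The system G(p,z) <= 0, H(p,z) = 0 in z in R^d, with parameter p in R^s. *)
Context {s d k l : nat}.
Variables (G : 'rV[R]_s -> 'rV[R]_d -> 'rV[R]_k)
          (H : 'rV[R]_s -> 'rV[R]_d -> 'rV[R]_l).

Definition feasible (p : 'rV[R]_s) : set 'rV[R]_d :=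
  [set z | (forall i, G p z 0 i <= 0) /\ H p z = 0].

Definition multipliers (beta : 'rV[R]_d) (p : 'rV[R]_s) (z : 'rV[R]_d) :
    set ('rV[R]_k * 'rV[R]_l) :=
  [set ab | [/\ beta - ab.1 *m ('J (G p) z)^T - ab.2 *m ('J (H p) z)^T = 0,
                complementary ab.1 (- G p z) & H p z = 0]].

Definition local_maximizer (Z : set 'rV[R]_d) (phi : 'rV[R]_d -> R)
    (zbar : 'rV[R]_d) : Prop :=
  Z zbar /\ \forall z \near zbar, Z z -> phi z <= phi zbar.

Definition CQ_at (p : 'rV[R]_s) (zbar : 'rV[R]_d) : Prop :=
  forall phi : 'rV[R]_d -> R, C1 phi ->
    local_maximizer (feasible p) phi zbar ->
    multipliers (grad phi zbar) p zbar !=set0.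

(* Q p z : the condition Q holds at the point z in feasible p. *)
Definition stable_parametric_CQ (Q : 'rV[R]_s -> 'rV[R]_d -> Prop) : Prop :=
  forall (pbar : 'rV[R]_s) (zbar : 'rV[R]_d),
  feasible pbar zbar -> Q pbar zbar ->
  [/\ \forall pz \near (pbar, zbar), feasible pz.1 pz.2 -> Q pz.1 pz.2,
      CQ_at pbar zbar
    & forall (betabar : 'rV[R]_d) (beta z : nat -> 'rV[R]_d)
             (p : nat -> 'rV[R]_s),
      beta j @[j --> \oo] --> betabar ->
      z j @[j --> \oo] --> zbar ->
      p j @[j --> \oo] --> pbar ->
      (forall j, multipliers (beta j) (p j) (z j) !=set0) ->
      exists (a : nat -> 'rV[R]_k) (b : nat -> 'rV[R]_l)
             (sigma : nat -> nat) (abar : 'rV[R]_k) (bbar : 'rV[R]_l),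
        [/\ forall j, multipliers (beta j) (p j) (z j) (a j, b j),
            {homo sigma : i j / (i < j)%N},
            a (sigma j) @[j --> \oo] --> abar,
            b (sigma j) @[j --> \oo] --> bbar
          & multipliers betabar pbar zbar (abar, bbar)]].

End Parametric.

(* A system without parameter is a system with parameter in R^0 = {0}. *)
Section NonParametric.
Context {d k l : nat}.
Variables (G : 'rV[R]_d -> 'rV[R]_k) (H : 'rV[R]_d -> 'rV[R]_l).

Definition CQ (zbar : 'rV[R]_d) : Prop :=
  CQ_at (fun _ : 'rV[R]_0 => G) (fun _ : 'rV[R]_0 => H) 0 zbar.

Definition stable_CQ (Q : 'rV[R]_d -> Prop) : Prop :=
  stable_parametric_CQ (fun _ : 'rV[R]_0 => G) (fun _ : 'rV[R]_0 => H)
    (fun _ z => Q z).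

End NonParametric.

End ConstraintQualifications.

Section ValueFunction.
Context {R : realType} {n m q : nat}.
Variables (f : 'rV[R]_(n + m) -> R) (g : 'rV[R]_(n + m) -> 'rV[R]_q).
Implicit Types (x : 'rV[R]_n) (y u : 'rV[R]_m) (lam : 'rV[R]_q).

Definition feas x : set 'rV[R]_m :=
  [set y | forall i, g (row_mx x y) 0 i <= 0].

Definition value x : \bar R :=
  ereal_sup [set (f (row_mx x y))%:E | y in feas x].

Definition solutions x : set 'rV[R]_m :=
  [set y | feas x y /\ (f (row_mx x y))%:E = value x].

Definition Lagr x y lam : R := f (row_mx x y) - dot (g (row_mx x y)) lam.

Definition gradx_Lagr x y lam : 'rV[R]_n := grad (fun x' => Lagr x' y lam) x.

Definition grady_Lagr x y lam : 'rV[R]_m := grad (fun y' => Lagr x y' lam) y.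

Definition hessxy_Lagr x y lam : 'M[R]_(n, m) :=
  'J (fun x' => grady_Lagr x' y lam) x.

Definition hessyy_Lagr x y lam : 'M[R]_(m, m) :=
  'J (fun y' => grady_Lagr x y' lam) y.

Definition grady_g x y : 'M[R]_(m, q) := 'J (fun y' => g (row_mx x y')) y.

Definition Sigma x y : set 'rV[R]_q :=
  [set lam | grady_Lagr x y lam = 0 /\ complementary (- g (row_mx x y)) lam].

Definition Xi (r : R) x y lam : set 'rV[R]_m :=
  [set u | u *m (hessyy_Lagr x y lam)^T = 0 /\
     complementary (- (u *m grady_g x y) - r *: g (row_mx x y)) lam].

Definition restricted_sup_compact (xbar : 'rV[R]_n) : Prop :=
  value xbar \is a fin_num /\
  exists (eps delta : R) (Omega : set 'rV[R]_m),
    [/\ 0 < eps, 0 < delta, compact Omega &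
      forall x, `|x - xbar| < delta -> (value xbar - eps%:E < value x)%E ->
        solutions x `&` Omega !=set0].

(* The constraints g(x,y) <= 0, as a system in y with parameter x and no
   equality constraint. *)
Definition lower_ineq (x : 'rV[R]_n) (y : 'rV[R]_m) : 'rV[R]_q :=
  g (row_mx x y).

Definition lower_eq (_ : 'rV[R]_n) (_ : 'rV[R]_m) : 'rV[R]_0 := 0.

(* The system - lam <= 0, nabla_y L(x,y,lam) = 0 in z = (x, y, lam). *)
Definition dual_pt x y lam : 'rV[R]_(n + m + q) := row_mx (row_mx x y) lam.

Definition dual_ineq (z : 'rV[R]_(n + m + q)) : 'rV[R]_q := - rsubmx z.

Definition dual_eq (z : 'rV[R]_(n + m + q)) : 'rV[R]_m :=
  grady_Lagr (lsubmx (lsubmx z)) (rsubmx (lsubmx z)) (rsubmx z).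

End ValueFunction.

(* Main.v *)
Require Import Defs.
From HB Require Import structures.
From mathcomp Require Import all_boot all_order all_algebra.
From mathcomp Require Import all_classical all_reals all_analysis.
From mathcomp Require Import ring lra.

Set Implicit Arguments.
Unset Strict Implicit.
Unset Printing Implicit Defensive.

Import Order.TTheory GRing.Theory Num.Theory.
Import numFieldNormedType.Exports.

Local Open Scope classical_set_scope.
Local Open Scope ring_scope.

(** Fix x near xbar.  Since f(x, .) is concave and the g_i(x, .) are convex, every
    (x, y, lam) with grad_y L(x, y, lam) = 0 and lam >= 0 satisfies
    V(x) <= L(x, y, lam), by Wolfe duality ([weak_duality]), with equality when
    y solves the problem at x and lam is a multiplier of y ([value_eq_Lagr]).  Thus V
    is bounded above by the smooth function L on the dual system, whereas a
    regular subgradient w of V at x provides, up to o(|x' - x|), a lower bound of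
    V(x') by the affine function with slope w.  Hence (x, y, lam) minimizes
    L(x', y', lam') - w.x' + o(|x' - x|) locally over the dual system.

    A constraint qualification speaks about C1 objectives only, so the o(.) term
    has to be majorized by a C1 function that vanishes together with its
    gradient at x.  This is the one-dimensional construction [C1_gauge], from
    which [regular_subdiff_C1_minorant] follows.  The qualification now yields
    multipliers (a, b) of the dual system for the gradient
    (w - grad_x L, 0, g) ([regular_dual_multipliers]); spelling out the KKT
    equations in the three blocks of variables gives
    w = grad_x L + (grad^2_xy L) b with b in Xi^1 ([dual_multipliers_Xi]).  This
    is the first inclusion.

    For limits t_k w_k of (multiples of) regular subgradients at x_k, restricted
    sup-compactness gives convergent solutions y_k, the stable qualification of
    the lower level problem convergent multipliers lam_k, and the stable
    qualification of the dual system convergent multipliers (a_k, b_k) for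
    t_k (w_k - grad_x L, 0, g).  Passing to the limit with t_k --> r gives the
    equations with Xi^r ([value_subdiff_limit]); r = 1 and r = 0 are the limiting
    and the singular inclusion. *)

(** * Calculus on row vectors *)

Section DotProduct.
Context {R : realType} {d : nat}.
Implicit Types u v w : 'rV[R]_d.

Lemma dot_mxE u v : dot u v = (u *m v^T) 0 0.
Proof. by rewrite mxE; apply: eq_bigr => i _; rewrite mxE. Qed.

Lemma dotC u v : dot u v = dot v u.
Proof. by apply: eq_bigr => i _; rewrite mulrC. Qed.

Lemma dotDl u v w : dot (u + v) w = dot u w + dot v w.
Proof. by rewrite !dot_mxE mulmxDl mxE. Qed.

Lemma dotNl u w : dot (- u) w = - dot u w.
Proof. by rewrite !dot_mxE mulNmx mxE. Qed.

Lemma dotZl a u w : dot (a *: u) w = a * dot u w.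
Proof. by rewrite !dot_mxE -scalemxAl mxE. Qed.

Lemma dotDr u v w : dot w (u + v) = dot w u + dot w v.
Proof. by rewrite !(dotC w) dotDl. Qed.

Lemma dotNr u w : dot w (- u) = - dot w u.
Proof. by rewrite !(dotC w) dotNl. Qed.

Lemma dotZr a u w : dot w (a *: u) = a * dot w u.
Proof. by rewrite !(dotC w) dotZl. Qed.

Lemma dot0l w : dot 0 w = 0.
Proof. by rewrite dot_mxE mul0mx mxE. Qed.

Lemma dot0r w : dot w 0 = 0.
Proof. by rewrite dotC dot0l. Qed.

Lemma dot_delta w i : dot w (delta_mx 0 i) = w 0 i.
Proof.
rewrite /dot (bigD1 i)//= big1 ?addr0 => [|j ji]; rewrite mxE eqxx ?mulr1 //=.
  by rewrite eqxx mulr1.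
by rewrite (negbTE ji) mulr0.
Qed.

Lemma dot_inj u v : (forall w, dot u w = dot v w) -> u = v.
Proof. by move=> h; apply/rowP => i; rewrite -!dot_delta. Qed.

Lemma dot_linear w : linear (dot w).
Proof. by move=> a u v; rewrite dotDr dotZr. Qed.

End DotProduct.

HB.instance Definition _ (R : realType) d (w : 'rV[R]_d) :=
  GRing.isLinear.Build R 'rV[R]_d R _ (dot w) (dot_linear w).

(** The constraint qualifications involve matrices *m (_)^T; testing against a vector
    moves them to a directional derivative. *)
Lemma dot_mulmxl (R : realType) d e (a : 'rV[R]_e) (M : 'M[R]_(d, e)) v :
  dot (a *m M^T) v = dot a (v *m M).
Proof. by rewrite !dot_mxE trmx_mul mulmxA. Qed.

Lemma dot_row_mx (R : realType) d e (u1 v1 : 'rV[R]_d) (u2 v2 : 'rV[R]_e) :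
  dot (row_mx u1 u2) (row_mx v1 v2) = dot u1 v1 + dot u2 v2.
Proof. by rewrite !dot_mxE tr_row_mx mul_row_col mxE. Qed.

Section RowVectorAnalysis.
Context {R : realType}.

Lemma cvg_rV (T : Type) (F : set_system T) {FF : Filter F} k
    (D : T -> 'rV[R]_k) (l : 'rV[R]_k) :
  (forall i, D t 0 i @[t --> F] --> l 0 i) -> D t @[t --> F] --> l.
Proof.
move=> h A [P Pl PA].
have : \forall t \near F, forall i, P 0 i (D t 0 i).
  by apply: filter_forall => i; apply: h; exact: Pl.
by apply: filterS => t Pt; apply: PA => i j; rewrite ord1.
Qed.

Lemma cvg_coord (T : Type) (F : set_system T) {FF : Filter F} k
    (D : T -> 'rV[R]_k) (l : 'rV[R]_k) i :
  D t @[t --> F] --> l -> D t 0 i @[t --> F] --> l 0 i.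
Proof. by move=> h; exact: cvg_comp h (@coord_continuous _ _ _ 0 i l). Qed.

Lemma cvg_sumr (T : Type) (F : set_system T) {FF : Filter F}
    (V : normedModType R) (I : finType) (f : I -> T -> V) (l : I -> V) :
  (forall i, f i t @[t --> F] --> l i) ->
  \sum_i f i t @[t --> F] --> \sum_i l i.
Proof. by move=> h; apply: cvg_big => //; exact: add_continuous. Qed.

Lemma continuous_mulmxr k l (M : 'M[R]_(k, l)) :
  continuous (fun z : 'rV[R]_k => z *m M).
Proof.
move=> z; apply: (@cvg_rV _ (nbhs z)) => i.
rewrite (_ : (fun t : 'rV_k => _) = (fun t : 'rV_k => \sum_j t 0 j * M j i)); last first.
  by apply/funext => t; rewrite mxE.
rewrite mxE; apply: cvg_sumr => j; apply: cvgMl; exact: coord_continuous.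
Qed.

Lemma continuous_dot d (w : 'rV[R]_d) : continuous (dot w).
Proof.
move=> z; rewrite (_ : dot w = fun v => (v *m w^T) 0 0); last first.
  by apply/funext => v; rewrite dotC dot_mxE.
by apply: (@cvg_coord _ (nbhs z)); exact: continuous_mulmxr.
Qed.

Lemma is_diff_linear (V W : normedModType R) (L : {linear V -> W}) z :
  continuous L -> is_diff z L L.
Proof.
by move=> cL; apply: DiffDef; [exact: linear_differentiable|rewrite diff_lin].
Qed.

Lemma is_diff_mulmxr k l (M : 'M[R]_(k, l)) (z : 'rV[R]_k) :
  is_diff z (fun z : 'rV[R]_k => z *m M) (mulmxr M).
Proof. by apply: (is_diff_linear (L := mulmxr M)); exact: continuous_mulmxr. Qed.

Lemma is_diff_affine k l (b : 'rV[R]_l) (M : 'M[R]_(k, l)) (z : 'rV[R]_k) :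
  is_diff z (fun z : 'rV[R]_k => b + z *m M) (mulmxr M).
Proof.
have h := is_diff_mulmxr M z.
by apply: is_diff_eq (is_diffD (is_diff_cst b z) h) _; apply/funext => v; rewrite add0r.
Qed.

Lemma is_diff_sum (V W : normedModType R) (I : finType) (f df : I -> V -> W) z :
  (forall i, is_diff z (f i) (df i)) ->
  is_diff z (fun t => \sum_i f i t) (fun v => \sum_i df i v).
Proof.
move=> h; rewrite -!fct_sumE; elim/big_ind2 : _ => //.
  exact: is_diff_cst.
by move=> *; apply: is_diffD.
Qed.

Lemma is_diff_rV (V : normedModType R) k (F L : V -> 'rV[R]_k) z :
  (forall i, is_diff z (fun t => F t 0 i) (fun v => L v 0 i)) ->
  is_diff z F L.
Proof.
move=> h.
rewrite (_ : F = fun t => \sum_i F t 0 i *: delta_mx 0 i); last first.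
  by apply/funext => t; rewrite -row_sum_delta.
rewrite (_ : L = fun t => \sum_i L t 0 i *: delta_mx 0 i); last first.
  by apply/funext => t; rewrite -row_sum_delta.
by apply: is_diff_sum => i; apply: is_diff_comp (h i) (is_diff_scalel _ _).
Qed.

End RowVectorAnalysis.

Section Gradient.
Context {R : realType}.

(** Differentiability and the value of the gradient in one statement, so that the
    rules of calculus produce both at once. *)
Definition has_gradient d (phi : 'rV[R]_d -> R) (z w : 'rV[R]_d) : Prop :=
  is_diff z phi (dot w).

Lemma has_gradient_grad d (phi : 'rV[R]_d -> R) z w :
  has_gradient phi z w -> grad phi z = w.
Proof.
move=> h; have dphi : differentiable phi z by case: h.
by apply/rowP => i; rewrite mxE deriveE// (diff_val (is_diff_def := h)) dot_delta.
Qed.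

Lemma differentiable_has_gradient d (phi : 'rV[R]_d -> R) z :
  differentiable phi z -> has_gradient phi z (grad phi z).
Proof.
move=> h; apply: DiffDef => //; apply/funext => v.
rewrite {1}(row_sum_delta v) linear_sum dotC; apply: eq_bigr => i _.
by rewrite linearZ/= mxE deriveE.
Qed.

Lemma C1_has_gradient d (phi : 'rV[R]_d -> R) z :
  C1 phi -> has_gradient phi z (grad phi z).
Proof. by move=> [h _]; exact: differentiable_has_gradient. Qed.

Lemma has_gradient_C1 d (phi : 'rV[R]_d -> R) D :
  (forall z, has_gradient phi z (D z)) -> continuous D -> C1 phi.
Proof.
move=> h cD; split; first by move=> z; have := h z => -[].
by rewrite (_ : grad phi = D)//; apply/funext => z; exact: has_gradient_grad.
Qed.

Lemma has_gradientD d (phi psi : 'rV[R]_d -> R) z w v :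
  has_gradient phi z w -> has_gradient psi z v ->
  has_gradient (fun t => phi t + psi t) z (w + v).
Proof.
move=> h k; apply: is_diff_eq (is_diffD h k) _.
by apply/funext => u; rewrite dotDl.
Qed.

Lemma has_gradientN d (phi : 'rV[R]_d -> R) z w :
  has_gradient phi z w -> has_gradient (fun t => - phi t) z (- w).
Proof.
move=> h; apply: is_diff_eq (is_diffN h) _.
by apply/funext => u; rewrite dotNl.
Qed.

Lemma has_gradientM d (phi psi : 'rV[R]_d -> R) z w v :
  has_gradient phi z w -> has_gradient psi z v ->
  has_gradient (fun t => phi t * psi t) z (phi z *: v + psi z *: w).
Proof.
move=> h k; apply: is_diff_eq (is_diffM h k) _.
by apply/funext => u; rewrite dotDl !dotZl.
Qed.

Lemma has_gradient_sum d (I : finType) (phi : I -> 'rV[R]_d -> R) z w :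
  (forall i, has_gradient (phi i) z (w i)) ->
  has_gradient (fun t => \sum_i phi i t) z (\sum_i w i).
Proof.
move=> h; apply: is_diff_eq (is_diff_sum h) _.
by apply/funext => u; rewrite dotC linear_sum; apply: eq_bigr => i _; rewrite dotC.
Qed.

Lemma has_gradient_affine d e (phi : 'rV[R]_d -> R) (b : 'rV[R]_d)
    (M : 'M[R]_(e, d)) z w :
  has_gradient phi (b + z *m M) w ->
  has_gradient (fun t => phi (b + t *m M)) z (w *m M^T).
Proof.
move=> h; apply: is_diff_eq (is_diff_comp (is_diff_affine b M z) h) _.
by apply/funext => u; rewrite /= dot_mulmxl.
Qed.

Lemma has_gradient_dot d (w z : 'rV[R]_d) : has_gradient (dot w) z w.
Proof. by apply: is_diff_linear; exact: continuous_dot. Qed.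

Lemma has_gradient_cst d (a : R) (z : 'rV[R]_d) : has_gradient (fun=> a) z 0.
Proof.
apply: is_diff_eq (is_diff_cst a z) _.
by apply/funext => u; rewrite dot0l.
Qed.

Lemma C1_dot d (w : 'rV[R]_d) : C1 (dot w).
Proof.
apply: (@has_gradient_C1 _ _ (fun=> w)) => [z|]; last exact: cst_continuous.
exact: has_gradient_dot.
Qed.

Lemma C1_coord d i : C1 (fun z : 'rV[R]_d => z 0 i).
Proof.
rewrite (_ : (fun _ => _) = dot (delta_mx 0 i)); first exact: C1_dot.
by apply/funext => z; rewrite dotC dot_delta.
Qed.

Lemma C1_continuous d (phi : 'rV[R]_d -> R) : C1 phi -> continuous phi.
Proof. by move=> [h _] z; exact: differentiable_continuous. Qed.

Lemma C1D d (phi psi : 'rV[R]_d -> R) :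
  C1 phi -> C1 psi -> C1 (fun t => phi t + psi t).
Proof.
move=> h k; apply: (@has_gradient_C1 _ _ (fun t => grad phi t + grad psi t)).
  by move=> z; apply: has_gradientD; exact: C1_has_gradient.
by move=> z; exact: continuousD (h.2 z) (k.2 z).
Qed.

Lemma C1N d (phi : 'rV[R]_d -> R) : C1 phi -> C1 (fun t => - phi t).
Proof.
move=> h; apply: (@has_gradient_C1 _ _ (fun t => - grad phi t)).
  by move=> z; apply: has_gradientN; exact: C1_has_gradient.
by move=> z; exact: continuousN (h.2 z).
Qed.

Lemma C1M d (phi psi : 'rV[R]_d -> R) :
  C1 phi -> C1 psi -> C1 (fun t => phi t * psi t).
Proof.
move=> h k; apply: (@has_gradient_C1 _ _
  (fun t => phi t *: grad psi t + psi t *: grad phi t)).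
  by move=> z; apply: has_gradientM; exact: C1_has_gradient.
move=> z; exact: continuousD (continuousZ (C1_continuous h (x := z)) (k.2 z))
  (continuousZ (C1_continuous k (x := z)) (h.2 z)).
Qed.

Lemma C1_sum d (I : finType) (phi : I -> 'rV[R]_d -> R) :
  (forall i, C1 (phi i)) -> C1 (fun t => \sum_i phi i t).
Proof.
move=> h; apply: (@has_gradient_C1 _ _ (fun t => \sum_i grad (phi i) t)).
  by move=> z; apply: has_gradient_sum => i; exact: C1_has_gradient.
by move=> z; exact: (@cvg_sumr _ _ (nbhs z) _ _ _ (fun i => grad (phi i))
  (fun i => grad (phi i) z) (fun i => (h i).2 z)).
Qed.

Lemma C1_affine d e (phi : 'rV[R]_d -> R) (b : 'rV[R]_d) (M : 'M[R]_(e, d)) :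
  C1 phi -> C1 (fun t : 'rV[R]_e => phi (b + t *m M)).
Proof.
move=> h; apply: (@has_gradient_C1 _ _ (fun t => grad phi (b + t *m M) *m M^T)).
  by move=> z; apply: has_gradient_affine; exact: C1_has_gradient.
move=> z; have [/differentiable_continuous cb _] := is_diff_affine b M z.
exact: continuous_comp (continuous_comp cb (h.2 _)) (@continuous_mulmxr _ _ _ M^T _).
Qed.

Lemma C1_lsubmx d e (phi : 'rV[R]_d -> R) :
  C1 phi -> C1 (fun z : 'rV[R]_(d + e) => phi (lsubmx z)).
Proof.
move=> h; rewrite (_ : (fun _ => _) =
    fun z : 'rV[R]_(d + e) => phi (0 + z *m col_mx 1%:M 0)).
  exact: C1_affine.
apply/funext => z; rewrite add0r -[in RHS](hsubmxK z) mul_row_col.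
by rewrite mulmx1 mulmx0 addr0.
Qed.

Lemma C1_rsubmx d e (phi : 'rV[R]_e -> R) :
  C1 phi -> C1 (fun z : 'rV[R]_(d + e) => phi (rsubmx z)).
Proof.
move=> h; rewrite (_ : (fun _ => _) =
    fun z : 'rV[R]_(d + e) => phi (0 + z *m col_mx 0 1%:M)).
  exact: C1_affine.
apply/funext => z; rewrite add0r -[in RHS](hsubmxK z) mul_row_col.
by rewrite mulmx1 mulmx0 add0r.
Qed.

End Gradient.

Section RowMx.
Context {R : realType}.

Lemma has_gradient_row_mxl d e (phi : 'rV[R]_(d + e) -> R) x y w :
  has_gradient phi (row_mx x y) w ->
  has_gradient (fun t => phi (row_mx t y)) x (lsubmx w).
Proof.
have row_affine (t : 'rV[R]_d) : row_mx t y = row_mx 0 y + t *m row_mx 1%:M 0.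
  by rewrite mul_mx_row mulmx1 mulmx0 add_row_mx add0r addr0.
rewrite (_ : (fun t => _) = fun t => phi (row_mx 0 y + t *m row_mx 1%:M 0)); last first.
  by apply/funext => t; rewrite row_affine.
rewrite row_affine => /has_gradient_affine.
by rewrite -{1}(hsubmxK w) tr_row_mx mul_row_col trmx1 trmx0 mulmx1 mulmx0 addr0.
Qed.

Lemma has_gradient_row_mxr d e (phi : 'rV[R]_(d + e) -> R) x y w :
  has_gradient phi (row_mx x y) w ->
  has_gradient (fun t => phi (row_mx x t)) y (rsubmx w).
Proof.
have row_affine (t : 'rV[R]_e) : row_mx x t = row_mx x 0 + t *m row_mx 0 1%:M.
  by rewrite mul_mx_row mulmx1 mulmx0 add_row_mx add0r addr0.
rewrite (_ : (fun t => _) = fun t => phi (row_mx x 0 + t *m row_mx 0 1%:M)); last first.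
  by apply/funext => t; rewrite row_affine.
rewrite row_affine => /has_gradient_affine.
by rewrite -{1}(hsubmxK w) tr_row_mx mul_row_col trmx1 trmx0 mulmx1 mulmx0 add0r.
Qed.

Lemma is_diff_row_mxl (V : normedModType R) d e (F L : V -> 'rV[R]_d) (b : 'rV[R]_e) z :
  is_diff z F L -> is_diff z (fun t => row_mx (F t) b) (fun v => row_mx (L v) 0).
Proof.
move=> h; rewrite (_ : (fun t => row_mx _ b) = (fun t => row_mx 0 b + t *m row_mx 1%:M 0) \o F).
  apply: is_diff_eq (is_diff_comp h (is_diff_affine (row_mx 0 b) (row_mx 1%:M 0) (F z))) _.
  by apply/funext => v; rewrite /= mul_mx_row mulmx1 mulmx0.
by apply/funext => t; rewrite /= mul_mx_row mulmx1 mulmx0 add_row_mx add0r addr0.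
Qed.

Lemma is_diff_row_mxr (V : normedModType R) d e (F L : V -> 'rV[R]_e) (b : 'rV[R]_d) z :
  is_diff z F L -> is_diff z (fun t => row_mx b (F t)) (fun v => row_mx 0 (L v)).
Proof.
move=> h; rewrite (_ : (fun t => row_mx b _) = (fun t => row_mx b 0 + t *m row_mx 0 1%:M) \o F).
  apply: is_diff_eq (is_diff_comp h (is_diff_affine (row_mx b 0) (row_mx 0 1%:M) (F z))) _.
  by apply/funext => v; rewrite /= mul_mx_row mulmx1 mulmx0.
by apply/funext => t; rewrite /= mul_mx_row mulmx1 mulmx0 add_row_mx add0r addr0.
Qed.

Lemma mulmx_jacobian d e (F : 'rV[R]_d -> 'rV[R]_e) z v : v *m 'J F z = 'd F z v.
Proof. by rewrite /jacobian mul_rV_lin1. Qed.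

Lemma is_diff_jacobian d e (F L : 'rV[R]_d -> 'rV[R]_e) z v :
  is_diff z F L -> v *m 'J F z = L v.
Proof. by move=> h; rewrite mulmx_jacobian diff_val. Qed.

Lemma jacobian_grad d e (F : 'rV[R]_d -> 'rV[R]_e) z i j :
  (forall k, differentiable (fun t => F t 0 k) z) ->
  'J F z i j = grad (fun t => F t 0 j) z 0 i.
Proof.
move=> dF.
have hF : is_diff z F (fun v => \row_k dot (grad (fun t => F t 0 k) z) v).
  apply: is_diff_rV => k; apply: is_diff_eq (differentiable_has_gradient (dF k)) _.
  by apply/funext => v; rewrite mxE.
by rewrite /jacobian mxE diff_val mxE dot_delta.
Qed.

Lemma differentiable_rV (V : normedModType R) k (F : V -> 'rV[R]_k) z :
  (forall i, differentiable (fun t => F t 0 i) z) -> differentiable F z.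
Proof.
move=> dF; suff h : is_diff z F (fun v => \row_i 'd (fun t => F t 0 i) z v) by case: h.
apply: is_diff_rV => i; apply: DiffDef; first exact: dF.
by apply/funext => v; rewrite mxE.
Qed.

End RowMx.

(** * C1 majorants of a little-o *)

Section Gauge.
Context {R : realType}.
Variable delta : R -> R.
Hypothesis delta_gt0 : forall e, 0 < e -> 0 < delta e.

(** The infimum over e of the affine functions s |-> e + s / delta e: it tends
    to 0 with s (choose e first, then s), and a value of it at s close to the
    infimum and smaller than 1 comes from an e with s < delta e. *)
Let modulus_set (s : R) : set R :=
  [set e + Num.max s 0 / delta e | e in [set e | 0 < e]].

Let modulus (s : R) : R := inf (modulus_set s).

Let modulus_set_neq0 s : modulus_set s !=set0.
Proof. by exists (1 + Num.max s 0 / delta 1); exists 1 => //=; exact: ltr01. Qed.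

Let modulus_set_ge0 s : lbound (modulus_set s) 0.
Proof.
move=> _ [e /= e0 <-]; rewrite addr_ge0 ?(ltW e0)//.
by rewrite divr_ge0// ?le_max ?lexx ?orbT// ltW// delta_gt0.
Qed.

Let modulus_le s e : 0 < e -> modulus s <= e + Num.max s 0 / delta e.
Proof.
move=> e0; apply: ge_inf; first by exists 0; exact: modulus_set_ge0.
by exists e.
Qed.

Let le_modulus s b :
  (forall e, 0 < e -> b <= e + Num.max s 0 / delta e) -> b <= modulus s.
Proof.
move=> h; apply: lb_le_inf; first exact: modulus_set_neq0.
by move=> _ [e /= e0 <-]; exact: h.
Qed.

Let modulus_ge0 s : 0 <= modulus s.
Proof. by apply: lb_le_inf; [exact: modulus_set_neq0|exact: modulus_set_ge0]. Qed.

Let modulus_homo s t : s <= t -> modulus s <= modulus t.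
Proof.
move=> st; apply: le_modulus => e e0; apply: le_trans (modulus_le _ e0) _.
rewrite lerD2l ler_pM2r ?invr_gt0 ?delta_gt0//.
by rewrite ge_max !le_max st lexx orbT.
Qed.

(** An infimum of affine functions with nonnegative value at 0 is concave, which
    forces its slope from the origin to decrease.  This replaces concavity in
    the proof of continuity. *)
Let modulus_ratio s t : 0 < s -> s <= t -> modulus t / t <= modulus s / s.
Proof.
move=> s0 st; have t0 : 0 < t by exact: lt_le_trans st.
rewrite ler_pdivlMr//; apply: le_modulus => e e0.
have := modulus_le t e0; rewrite !max_l ?(ltW s0) ?(ltW t0)// => h.
rewrite mulrAC ler_pdivrMr//.
have hs : modulus t * s <= (e + t / delta e) * s by rewrite ler_pM2r.
have es : e * s <= e * t by rewrite ler_pM2l.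
apply: le_trans hs _; rewrite !mulrDl [t / _ * s]mulrAC [s / _ * t]mulrAC.
by rewrite [t * s]mulrC lerD2r.
Qed.

Let modulus_near0 e : 0 < e -> \forall s \near (0 : R), modulus s < e.
Proof.
move=> e0; have e20 : 0 < e / 2 by rewrite divr_gt0.
have d0 := delta_gt0 e20; near=> s.
apply: le_lt_trans (modulus_le _ e20) _.
suff : Num.max s 0 / delta (e / 2) < e / 2 by lra.
rewrite ltr_pdivrMr// gt_max mulr_gt0// andbT.
by near: s; apply: lt_nbhsl; rewrite mulr_gt0.
Unshelve. all: by end_near. Qed.

Let modulus_le0 s : s <= 0 -> modulus s = 0.
Proof.
move=> s0; apply/eqP; rewrite eq_le modulus_ge0 andbT.
apply/ler_addgt0Pl => e e0; rewrite addr0.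
have [t /=] := filter_ex (modulus_near0 e0); move=> /ltW.
apply: le_trans.
(* the modulus does not distinguish nonpositive arguments *)
rewrite (_ : modulus s = modulus (Num.min s t)); last first.
  rewrite /modulus /modulus_set; congr (inf _); apply/eq_imagel => e' _ /=.
  by rewrite !max_r// ge_min s0.
by apply: modulus_homo; rewrite ge_min lexx orbT.
Qed.

Let modulus_continuous : continuous modulus.
Proof.
move=> s; have [s0|s0] := leP s 0.
  apply/cvgrPdist_lt => e e0; rewrite (modulus_le0 s0).
  have [s0'|/eqP s0'] := eqVneq s 0.
    rewrite s0'; apply: filterS (modulus_near0 e0) => t.
    by rewrite sub0r normrN ger0_norm.
  near=> t; rewrite modulus_le0 ?subrr ?normr0//.
  apply/ltW; near: t; apply: lt_nbhsl.
  by rewrite lt_neqAle s0 andbT; apply/eqP.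
(* The slope from the origin at s / 2 is a Lipschitz constant on [s / 2, +oo[. *)
pose K := modulus (s / 2) / (s / 2).
have s20 : 0 < s / 2 by rewrite divr_gt0.
have K0 : 0 <= K by rewrite divr_ge0// ltW.
have lip u v : s / 2 <= u -> u <= v -> modulus v - modulus u <= K * (v - u).
  move=> su uv; have u0 : 0 < u by exact: lt_le_trans su.
  have v0 : 0 < v by exact: lt_le_trans uv.
  have := modulus_ratio u0 uv; rewrite ler_pdivrMr// => h.
  apply: le_trans (_ : modulus u / u * (v - u) <= _).
    by rewrite mulrBr divfK ?gt_eqF// lerD2r.
  by rewrite ler_wpM2r ?subr_ge0//; exact: modulus_ratio.
apply/cvgrPdist_lt => e e0; near=> t.
have st : s / 2 <= t.
  by apply/ltW; near: t; apply: lt_nbhsr; rewrite ltr_pdivrMr// ltr_pMr// ltr1n.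
have lip_abs : `|modulus s - modulus t| <= K * `|s - t|.
  have ss : s / 2 <= s by lra.
  have [h|/ltW h] := leP s t.
    by rewrite !ler0_norm ?subr_le0 ?modulus_homo// !opprB; exact: lip.
  by rewrite !ger0_norm ?subr_ge0 ?modulus_homo//; exact: lip.
apply: le_lt_trans lip_abs _.
apply: le_lt_trans (_ : (K + 1) * `|s - t| < _).
  by rewrite ler_wpM2r// lerDl.
rewrite mulrC -ltr_pdivlMr ?ltr_wpDl//.
near: t; apply: cvgr_dist_lt => //; first by rewrite divr_gt0// ltr_wpDl.
Unshelve. all: by end_near. Qed.

(** The quantifiers of a little-o, packed into one continuous function: if a
    bound e holds on ]0, delta e[ for every e > 0, then a bound c s holds at s
    for a continuous c with c 0 = 0. *)
Lemma continuous_modulus : exists c : R -> R,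
  [/\ continuous c, {homo c : s t / s <= t}, forall s, s <= 0 -> c s = 0 &
   exists2 r, 0 < r & forall s, 0 < s -> s < r ->
     exists e, [/\ 0 < e, s < delta e & e <= c s]].
Proof.
(* The infimum need not be attained; adding s leaves room for an e that almost
   attains it. *)
exists (fun s => modulus s + Num.max s 0); split.
- move=> s; apply: cvgD; first exact: modulus_continuous.
  by apply: continuous_max; [exact: cvg_id|exact: cvg_cst].
- move=> s t st; rewrite lerD ?modulus_homo//.
  by rewrite ge_max !le_max st lexx orbT.
- by move=> s s0; rewrite modulus_le0// max_r// addr0.
- have /nbhs_ballP[r /= r0 h] : \forall s \near (0 : R), modulus s < 1 / 2.
    exact: modulus_near0.
  exists (Num.min r (1 / 2)); first by rewrite lt_min r0 divr_gt0.
  move=> s s0; rewrite lt_min => /andP[sr s2]; rewrite max_l ?ltW//.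
  have hinf : has_inf (modulus_set s).
    split; first exact: modulus_set_neq0.
    by exists 0; exact: modulus_set_ge0.
  have [_ [e /= e0 <-]] := inf_adherent s0 hinf.
  rewrite -/(modulus s) max_l ?ltW// => es.
  have d0 := delta_gt0 e0.
  have sd0 : 0 < s / delta e by rewrite divr_gt0.
  exists e; split => //; last by lra.
  have ms : modulus s < 1 / 2.
    by apply: h; rewrite /ball/= sub0r normrN gtr0_norm.
  suff : s / delta e < 1 by rewrite ltr_pdivrMr// mul1r.
  lra.
Qed.

End Gauge.

Section Primitive.
Context {R : realType}.

(** Since c vanishes on the left, it is integrable on every ]-oo, u], so that a
    single base point -oo serves for the primitive on the whole line. *)
Lemma primitive_flat_left (c : R -> R) :
  continuous c -> (forall s, s <= 0 -> c s = 0) ->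
  exists F : R -> R,
    (forall t, is_derive t (1 : R) F (c t)) /\ (forall t, t <= 0 -> F t = 0).
Proof.
move=> cc c0.
exists (fun x => \int[lebesgue_measure]_(t in `]-oo, x]) c t); split; last first.
  move=> t t0; rewrite (@eq_Rintegral _ _ _ _ _ (cst 0)) ?Rintegral_cst ?mul0r//.
  by move=> s /set_mem /=; rewrite in_itv/= => st; rewrite c0// (le_trans st).
move=> t.
have ci : lebesgue_measure.-integrable `]-oo, t + 1] (EFin \o c).
  rewrite integrable_mkcond//.
  rewrite (_ : _ \_ _ = (EFin \o c) \_ `[0, t + 1]); last first.
    apply/funext => s; rewrite /patch !mem_setE !in_itv/=.
    by case: (leP 0 s) => [|/ltW s0] //=; rewrite c0 ?if_same.
  rewrite -integrable_mkcond//; apply: continuous_compact_integrable.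
    exact: segment_compact.
  exact: continuous_subspaceT.
have tt1 : t < t + 1 by rewrite ltrDl.
have [dF eF] := continuous_FTC1 tt1 ci (ltNyr _) (cc t).
by rewrite -eF derive1E; apply: DeriveDef.
Qed.

End Primitive.

Section Gauge1D.
Context {R : realType}.

(** A continuous nondecreasing c with e <= c s turns into a C1 function dominating
    e * s by integration: the integral of c over [0, 2 s] is at least its
    integral over [s, 2 s], hence at least s * c s.  Symmetrizing makes the
    function usable on both sides of 0. *)
Lemma C1_gauge (delta : R -> R) : (forall e, 0 < e -> 0 < delta e) ->
  exists H h : R -> R,
  [/\ forall t, is_derive t (1 : R) H (h t), continuous h, H 0 = 0, h 0 = 0 &
   (forall t, 0 <= H t) /\
   exists2 r, 0 < r & forall t, 0 < `|t| < r ->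
     exists e, [/\ 0 < e, `|t| < delta e & e * `|t| <= H t]].
Proof.
move=> delta_gt0.
have [c [cc c_homo c0 [r r0 hr]]] := continuous_modulus delta_gt0.
have [F [dF F0]] := primitive_flat_left cc c0.
have cge0 s : 0 <= c s.
  have [/c0 ->//|/ltW s0] := leP s 0.
  by rewrite -(c0 0)// c_homo.
have Fc : continuous F.
  move=> t; apply/differentiable_continuous/derivable1_diffP.
  by have := dF t => -[].
have F_mvt s t : s <= t -> exists2 x, s <= x & F t - F s = c x * (t - s).
  move=> st; have [|x] := @MVT_segment R F c s t st (fun x _ => dF x).
    exact: continuous_subspaceT.
  by rewrite in_itv/= => /andP[sx _]; exists x.
have F_ge0 t : 0 <= F t.
  have [/F0 ->//|/ltW t0] := leP t 0.
  have [x _] := F_mvt _ _ t0; rewrite (F0 0)// subr0 => ->.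
  by rewrite mulr_ge0 ?subr_ge0.
have F_ge t : 0 <= t -> c t * t <= F (2 * t).
  move=> t0; have tt : t <= 2 * t by lra.
  have [x tx] := F_mvt _ _ tt; rewrite (_ : 2 * t - t = t); last by ring.
  move=> e; apply: le_trans (_ : c x * t <= _); first by rewrite ler_wpM2r// c_homo.
  by rewrite -e; have := F_ge0 t; lra.
exists (fun t => F (2 * t) + F (- 2 * t)).
exists (fun t => c (2 * t) * 2 - c (- 2 * t) * 2); split.
- move=> t.
  have d2 (a : R) : is_derive t (1 : R) (fun t => F (a * t)) (c (a * t) * a).
    have da : is_derive t (1 : R) (fun t => a * t) a.
      have := @is_deriveZ _ _ _ (@id R) a t 1 1 (is_derive_id _ _).
      by rewrite /GRing.scale /= mulr1.
    exact: (@is_derive1_comp _ F _ t _ _ (dF (a * t)) da).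
  have := @is_deriveD _ _ _ _ _ _ _ _ _ (d2 2) (d2 (- 2)).
  by rewrite mulrN.
- move=> t.
  have cl (a : R) : {for t, continuous (fun t => c (a * t) * 2)}.
    apply: cvgMl; apply: (@continuous_comp _ _ _ (fun t => a * t) c); last exact: cc.
    by apply: cvgMr; exact: cvg_id.
  by apply: cvgB; exact: cl.
- by rewrite !mulr0 F0// addr0.
- by rewrite !mulr0 subrr.
split=> [t|]; first by rewrite addr_ge0.
exists r => // t /andP[t0 tr]; have [e [e0 te ec]] := hr _ t0 tr.
exists e; split => //; apply: le_trans (_ : c `|t| * `|t| <= _).
  by rewrite ler_wpM2r.
have := F_ge `|t| (normr_ge0 _).
have [/ger0_norm ->|/ltW /ler0_norm ->] := leP 0 t.
  by move=> h; apply: ler_wpDr (F_ge0 _) h.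
by rewrite [2 * - t]mulrN -mulNr; exact: ler_wpDl (F_ge0 _).
Qed.

End Gauge1D.

Section SmoothMinorant.
Context {R : realType} {n : nat}.

Lemma is_derive_is_diff (H : R -> R) (t dH : R) :
  is_derive t (1 : R) H dH -> is_diff t H (fun v => v * dH).
Proof.
move=> [/derivable1_diffP dif eH]; apply: DiffDef => //; apply/funext => v.
by rewrite diff1E// -eH derive1E.
Qed.

Lemma norm_rV_coord (v : 'rV[R]_n) : v != 0 -> exists i, `|v| = `|v 0 i|.
Proof.
move=> v0; have : mx_norm v != 0.
  by apply: contraNneq v0 => /mx_norm_eq0 ->.
by move=> /mx_norm_neq0[[i j] e]; exists j; rewrite [LHS]e /= (ord1 i).
Qed.

(** The smooth variational description of regular subgradients.  The little-o
    is dominated by a sum of one-dimensional gauges in the coordinates, which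
    suffices because the norm of x - xs is the modulus of one of its
    coordinates. *)
Lemma regular_subdiff_C1_minorant (phi : 'rV[R]_n -> \bar R) xs w :
  regular_subdiff phi xs w ->
  exists h : 'rV[R]_n -> R, [/\ C1 h, h xs = 0, grad h xs = 0 &
    \forall x \near xs, (phi xs + (dot w (x - xs) - h x)%:E <= phi x)%E].
Proof.
move=> [phi_fin phi_near].
have /choice[delta hdelta] : forall e : R, exists r : R, 0 < e ->
    0 < r /\ forall x, `|x - xs| < r ->
      (phi xs + (dot w (x - xs) - e * `|x - xs|)%:E <= phi x)%E.
  move=> e; have [e0|e0] := ltP 0 e; last by exists 0.
  have /nbhs_normP[r /= r0 hr] := phi_near e e0; exists r; split => // x xr.
  by apply: hr; rewrite /= distrC.
have delta_gt0 e : 0 < e -> 0 < delta e by move=> /hdelta[].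
have [H [H' [dH cH' H0 H'0 [Hge0 [r r0 hr]]]]] := C1_gauge delta_gt0.
pose h (x : 'rV[R]_n) := \sum_i H (x 0 i - xs 0 i).
pose D i (x : 'rV[R]_n) : 'rV[R]_n := H' (x 0 i - xs 0 i) *: delta_mx 0 i.
have shift_diff i x : is_diff x (fun z : 'rV[R]_n => z 0 i - xs 0 i) (fun v => v 0 i).
  have hi : has_gradient (fun z : 'rV[R]_n => z 0 i) x (delta_mx 0 i).
    rewrite (_ : (fun _ => _) = dot (delta_mx 0 i)); first exact: has_gradient_dot.
    by apply/funext => z; rewrite dotC dot_delta.
  apply: is_diff_eq (is_diffB hi (is_diff_cst (xs 0 i) x)) _.
  by apply/funext => v; rewrite /= subr0 dotC dot_delta.
have grad_i i x : has_gradient (fun z : 'rV[R]_n => H (z 0 i - xs 0 i)) x (D i x).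
  apply: is_diff_eq (is_diff_comp (shift_diff i x) (is_derive_is_diff (dH _))) _.
  by apply/funext => v; rewrite /= dotZl dotC dot_delta mulrC.
have D_cont i : continuous (D i).
  move=> x; have [/differentiable_continuous ci _] := shift_diff i x.
  exact: continuousZr_tmp (continuous_comp ci (cH' _)).
have C1i i : C1 (fun z : 'rV[R]_n => H (z 0 i - xs 0 i)).
  exact: has_gradient_C1 (grad_i i) (D_cont i).
exists h; split.
- exact: C1_sum.
- by rewrite /h big1// => i _; rewrite subrr.
- apply: has_gradient_grad.
  rewrite (_ : 0 = \sum_i D i xs); first exact: has_gradient_sum.
  by rewrite big1// => i _; rewrite /D subrr H'0 scale0r.
apply/nbhs_normP; exists r => // x /=; rewrite distrC => xr.
have [->|xxs] := eqVneq x xs.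
  rewrite subrr dot0r /h big1 ?subr0 ?adde0// => i _.
  by rewrite subrr.
have [|i xi] := @norm_rV_coord (x - xs); first by rewrite subr_eq0.
rewrite !mxE in xi.
have [|e [e0 ei eH]] := hr (x 0 i - xs 0 i).
  by rewrite -xi xr normr_gt0 subr_eq0 xxs.
rewrite -xi in ei eH.
have [_ /(_ x ei)] := hdelta e e0; apply: le_trans.
rewrite leeD2l// lee_fin lerD2l lerN2; apply: le_trans eH _.
by rewrite /h (bigD1 i)//= lerDl sumr_ge0.
Qed.

End SmoothMinorant.

(** * Derivatives of the Lagrangian and of the dual system *)

Section LagrangianCalculus.
Context {R : realType} {n m q : nat}.
Variables (f : 'rV[R]_(n + m) -> R) (g : 'rV[R]_(n + m) -> 'rV[R]_q).
Hypotheses (f_C2 : C2 f) (g_C2 : forall i, C2 (fun z => g z 0 i)).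
Implicit Types (x : 'rV[R]_n) (y : 'rV[R]_m) (lam : 'rV[R]_q).

Let f_C1 : C1 f. Proof. exact: f_C2.1. Qed.
Let g_C1 i : C1 (fun z => g z 0 i). Proof. exact: (g_C2 i).1. Qed.

(** The gradient of the Lagrangian in (x, y) jointly, written in terms of the gradients
    of the data, where its dependence on the multiplier is affine. *)
Definition grad_Lagr (z : 'rV[R]_(n + m)) lam : 'rV[R]_(n + m) :=
  grad f z - \sum_j lam 0 j *: grad (fun t => g t 0 j) z.

Lemma has_gradient_Lagr z lam :
  has_gradient (fun t => f t - dot (g t) lam) z (grad_Lagr z lam).
Proof.
apply: has_gradientD; first exact: C1_has_gradient.
apply: has_gradientN; apply: has_gradient_sum => j.
have := has_gradientM (C1_has_gradient z (g_C1 j)) (has_gradient_cst (lam 0 j) z).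
by rewrite scaler0 add0r.
Qed.

Lemma has_gradient_Lagr_x x y lam :
  has_gradient (fun t => Lagr f g t y lam) x (lsubmx (grad_Lagr (row_mx x y) lam)).
Proof. exact: (has_gradient_row_mxl (has_gradient_Lagr (row_mx x y) lam)). Qed.

Lemma has_gradient_Lagr_y x y lam :
  has_gradient (fun t => Lagr f g x t lam) y (rsubmx (grad_Lagr (row_mx x y) lam)).
Proof. exact: (has_gradient_row_mxr (has_gradient_Lagr (row_mx x y) lam)). Qed.

Lemma gradx_LagrE x y lam :
  gradx_Lagr f g x y lam = lsubmx (grad_Lagr (row_mx x y) lam).
Proof. exact: has_gradient_grad (has_gradient_Lagr_x x y lam). Qed.

Lemma grady_LagrE x y lam :
  grady_Lagr f g x y lam = rsubmx (grad_Lagr (row_mx x y) lam).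
Proof. exact: has_gradient_grad (has_gradient_Lagr_y x y lam). Qed.

Lemma grady_g_grad x y i j :
  grady_g g x y i j = grad (fun t => g t 0 j) (row_mx x y) 0 (rshift n i).
Proof.
have hj k := has_gradient_row_mxr (C1_has_gradient (row_mx x y) (g_C1 k)).
rewrite /grady_g jacobian_grad; last by move=> k; case: (hj k).
by rewrite (has_gradient_grad (hj j)) mxE.
Qed.

Lemma grady_Lagr_affine x y lam :
  grady_Lagr f g x y lam
    = rsubmx (grad f (row_mx x y)) + lam *m - (grady_g g x y)^T.
Proof.
rewrite grady_LagrE mulmxN; apply/rowP => i.
rewrite [RHS]mxE [X in _ = _ + X]mxE [X in _ = _ - X]mxE !mxE summxE; congr (_ - _).
by apply: eq_bigr => j _; rewrite [_^T _ _]mxE grady_g_grad mxE.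
Qed.

Lemma C1_Lagr_joint : C1 (fun z : 'rV[R]_(n + m + q) =>
  Lagr f g (lsubmx (lsubmx z)) (rsubmx (lsubmx z)) (rsubmx z)).
Proof.
rewrite (_ : (fun z => _) = fun z : 'rV[R]_(n + m + q) =>
    f (lsubmx z) - dot (g (lsubmx z)) (rsubmx z)); last first.
  by apply/funext => z; rewrite /Lagr hsubmxK.
apply: C1D; first exact: C1_lsubmx.
apply: C1N; apply: C1_sum => j; apply: C1M.
  exact: (C1_lsubmx q (g_C1 j)).
exact: (@C1_rsubmx _ (n + m) q _ (C1_coord j)).
Qed.

Lemma dual_eq_coord_C1 i : C1 (fun z => dual_eq f g z 0 i).
Proof.
rewrite (_ : (fun z => _) = fun z => grad f (lsubmx z) 0 (rshift n i) -
    \sum_j rsubmx z 0 j * grad (fun t => g t 0 j) (lsubmx z) 0 (rshift n i)).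
  apply: C1D; first exact: (C1_lsubmx q (f_C2.2 (rshift n i))).
  apply: C1N; apply: C1_sum => j; apply: C1M.
    exact: (@C1_rsubmx _ (n + m) q _ (C1_coord j)).
  exact: (C1_lsubmx q ((g_C2 j).2 (rshift n i))).
apply/funext => z; rewrite /dual_eq grady_LagrE hsubmxK !mxE summxE; congr (_ - _).
by apply: eq_bigr => j _; rewrite !mxE.
Qed.

(** Each block is found by composing with the affine insertion of one variable,
    which turns the map of the dual system into a partial gradient of the
    Lagrangian; in the multiplier that gradient is affine. *)
Lemma diff_dual_eqE x y lam v1 v2 v3 :
  'd (dual_eq f g) (dual_pt x y lam) (row_mx (row_mx v1 v2) v3)
    = v1 *m hessxy_Lagr f g x y lam + v2 *m hessyy_Lagr f g x y lam
      - v3 *m (grady_g g x y)^T.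
Proof.
have dz : differentiable (dual_eq f g) (dual_pt x y lam).
  by apply: differentiable_rV => i; exact: (dual_eq_coord_C1 i).1.
have hz := differentiableP dz.
rewrite (_ : row_mx (row_mx v1 v2) v3 = row_mx (row_mx v1 0) 0
    + row_mx (row_mx 0 v2) 0 + row_mx 0 v3); last first.
  by rewrite !add_row_mx !addr0 !add0r.
rewrite !linearD/=; congr (_ + _ + _).
- have ix : is_diff x (fun t => dual_pt t y lam) (fun v => row_mx (row_mx v 0) 0).
    by apply: is_diff_row_mxl; apply: is_diff_row_mxl; exact: is_diff_id.
  have hx := is_diff_comp ix hz.
  rewrite (_ : _ \o _ = fun t => grady_Lagr f g t y lam) in hx; last first.
    by apply/funext => t; rewrite /dual_eq /= !(row_mxKl, row_mxKr).
  by rewrite /hessxy_Lagr (is_diff_jacobian v1 hx).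
- have iy : is_diff y (fun t => dual_pt x t lam) (fun v => row_mx (row_mx 0 v) 0).
    by apply: is_diff_row_mxl; apply: is_diff_row_mxr; exact: is_diff_id.
  have hx := is_diff_comp iy hz.
  rewrite (_ : _ \o _ = fun t => grady_Lagr f g x t lam) in hx; last first.
    by apply/funext => t; rewrite /dual_eq /= !(row_mxKl, row_mxKr).
  by rewrite /hessyy_Lagr (is_diff_jacobian v2 hx).
- have il : is_diff lam (fun t => dual_pt x y t) (fun v => row_mx 0 v).
    by apply: is_diff_row_mxr; exact: is_diff_id.
  have hl := is_diff_comp il hz.
  rewrite (_ : _ \o _ = fun t => rsubmx (grad f (row_mx x y))
      + t *m - (grady_g g x y)^T) in hl; last first.
    by apply/funext => t; rewrite /dual_eq /= !(row_mxKl, row_mxKr) grady_Lagr_affine.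
  have := diff_val (is_diff_def := hl).
  rewrite (diff_val (is_diff_def := is_diff_affine _ _ _)).
  by move=> /(congr1 (@^~ v3)) /= <-; rewrite mulmxN.
Qed.

Lemma dual_ineqE : @dual_ineq R n m q = fun z => 0 + z *m col_mx 0 (- 1%:M).
Proof.
apply/funext => z; rewrite /dual_ineq add0r -[in RHS](hsubmxK z) mul_row_col.
by rewrite mulmx0 add0r mulmxN mulmx1.
Qed.

(** The KKT system of the dual problem, read block by block.  With b in the role of u,
    the x-block expresses v through the mixed Hessian, the y-block annihilates
    the Hessian in y, and the multiplier block identifies a with the slack
    that Xi requires to be complementary to lam.  The scale r covers both the
    subgradients (r = 1) and their vanishing multiples (r = 0). *)
Lemma dual_multipliers_Xi (p : 'rV[R]_0) x y lam r v a b :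
  multipliers (fun _ => @dual_ineq R n m q) (fun _ => dual_eq f g)
    (row_mx (row_mx v 0) (r *: g (row_mx x y))) p (dual_pt x y lam) (a, b) ->
  v = b *m (hessxy_Lagr f g x y lam)^T /\ Xi f g r x y lam b.
Proof.
move=> [/= eq_mult compl _].
have eq_dot v1 v2 v3 :
    dot v v1 + dot (r *: g (row_mx x y)) v3 =
    - dot a v3 + dot b (v1 *m hessxy_Lagr f g x y lam
      + v2 *m hessyy_Lagr f g x y lam - v3 *m (grady_g g x y)^T).
  have := congr1 (fun u => dot u (row_mx (row_mx v1 v2) v3)) eq_mult.
  rewrite !dotDl !dotNl dot0l !dot_row_mx dot0l addr0 !dot_mulmxl.
  rewrite [X in dot a X](_ : _ = - v3); last first.
    rewrite dual_ineqE mulmx_jacobian.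
    rewrite (diff_val (is_diff_def := is_diff_affine _ _ _)) /=.
    by rewrite mul_row_col mulmx0 add0r mulmxN mulmx1.
  rewrite mulmx_jacobian diff_dual_eqE (dotNr v3).
  by move=> e; lra.
split.
  apply: dot_inj => v1; have := eq_dot v1 0 0.
  by rewrite !dot0r !mul0mx !subr0 !addr0 oppr0 add0r dot_mulmxl.
split.
  apply: dot_inj => v2; have := eq_dot 0 v2 0.
  by rewrite !dot0r !mul0mx oppr0 subr0 addr0 !add0r dot_mulmxl dot0l => <-.
suff -> : - (b *m grady_g g x y) - r *: g (row_mx x y) = a.
  by move: compl; rewrite /dual_ineq opprK /dual_pt row_mxKr.
apply: dot_inj => v3; have := eq_dot 0 0 v3.
rewrite !dot0r !mul0mx !add0r dotDl !dotNl dotNr.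
have -> : dot (b *m grady_g g x y) v3 = dot b (v3 *m (grady_g g x y)^T).
  by rewrite -dot_mulmxl trmxK.
by move=> e; lra.
Qed.

End LagrangianCalculus.

(** * Duality and regular subgradients *)

Section WeakDuality.
Context {R : realType}.

Lemma convex_function_le d (F : 'rV[R]_d -> R) (y z : 'rV[R]_d) t :
  convex_function [set: 'rV[R]_d] F -> 0 <= t -> t <= 1 ->
  F (t *: y + (1 - t) *: z) <= t * F y + (1 - t) * F z.
Proof.
move=> cF t0 t1; have := cF (Itv01 t0 t1) y z; rewrite !inE.
by apply.
Qed.

(** The difference quotients of F from y towards z are at most F z - F y and tend
    to 0. *)
Lemma convex_stationary_min d (F : 'rV[R]_d -> R) (y z : 'rV[R]_d) :
  (forall t, 0 <= t -> t <= 1 ->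
    F (t *: z + (1 - t) *: y) <= t * F z + (1 - t) * F y) ->
  has_gradient F y 0 -> F y <= F z.
Proof.
move=> F_conv F_stat; rewrite leNgt; apply/negP => Fzy.
have dF : differentiable F y by case: F_stat.
have Fl : h^-1 *: (F (h *: (z - y) + y) - F y) @[h --> (0 : R)^'] --> 'D_(z - y) F y.
  exact: diff_derivable.
rewrite deriveE// (diff_val (is_diff_def := F_stat)) dot0l in Fl.

have c0 : 0 < F y - F z by rewrite subr_gt0.
have /cvgrPdist_lt /(_ _ c0) /nbhs_ballP[r /= r0 hr] := Fl.
pose t := Num.min (r / 2) 1.
have t0 : 0 < t by rewrite lt_min ltr01 divr_gt0.
have t1 : t <= 1 by rewrite ge_min lexx orbT.
have tr : t < r by rewrite (@le_lt_trans _ _ (r / 2)) ?ge_min ?lexx// ltr_pdivrMr// ltr_pMr// ltr1n.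
have := hr t; rewrite /ball /= sub0r normrN gtr0_norm// => /(_ tr (lt0r_neq0 t0)).
rewrite sub0r normrN ltr_norml => /andP[+ _].
have -> : t *: (z - y) + y = t *: z + (1 - t) *: y.
  by rewrite scalerBr scalerBl scale1r addrA addrAC.
rewrite opprB /GRing.scale /= -ltr_pdivrMl ?invr_gt0// invrK.
by have := F_conv t (ltW t0) t1; lra.
Qed.

Context {n m q : nat}.
Variables (f : 'rV[R]_(n + m) -> R) (g : 'rV[R]_(n + m) -> 'rV[R]_q).
Hypotheses (f_C2 : C2 f) (g_C2 : forall i, C2 (fun z => g z 0 i)).
Implicit Types (x : 'rV[R]_n) (y : 'rV[R]_m) (lam : 'rV[R]_q).

(** Wolfe duality: at a stationary point of the concave function
    y |-> Lagr x y lam the Lagrangian attains its maximum, and that maximum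
    dominates the objective on the feasible set because lam >= 0. *)
Lemma weak_duality x y lam :
  convex_function [set: 'rV[R]_m] (fun y => - f (row_mx x y)) ->
  (forall i, convex_function [set: 'rV[R]_m] (fun y => g (row_mx x y) 0 i)) ->
  grady_Lagr f g x y lam = 0 -> (forall i, 0 <= lam 0 i) ->
  (value f g x <= (Lagr f g x y lam)%:E)%E.
Proof.
move=> f_conc g_conv stat lam0; apply: ge_ereal_sup => _ [z z_feas <-].
rewrite lee_fin; apply: le_trans (_ : f (row_mx x z) <= Lagr f g x z lam) _.
  rewrite /Lagr lerBrDl gerDr /dot sumr_le0// => i _.
  by rewrite mulr_le0_ge0.
rewrite -lerN2; apply: (@convex_stationary_min _ (fun y => - Lagr f g x y lam)).
  move=> t t0 t1; rewrite /Lagr !opprB.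
  have hf := convex_function_le z y f_conc t0 t1.
  have hg : dot (g (row_mx x (t *: z + (1 - t) *: y))) lam <=
      t * dot (g (row_mx x z)) lam + (1 - t) * dot (g (row_mx x y)) lam.
    rewrite /dot !mulr_sumr -big_split /=; apply: ler_sum => i _.
    rewrite !mulrA -mulrDl ler_wpM2r//.
    exact: (convex_function_le z y (g_conv i) t0 t1).
  by rewrite /= in hf; lra.
have := has_gradientN (has_gradient_Lagr_y f_C2 g_C2 x y lam).
by rewrite -grady_LagrE// stat oppr0.
Qed.

(** Complementary slackness closes the duality gap. *)
Lemma value_eq_Lagr x y lam :
  solutions f g x y -> Sigma f g x y lam -> value f g x = (Lagr f g x y lam)%:E.
Proof.
move=> [_ <-] [_ [_ _]]; rewrite dotNl => /eqP; rewrite oppr_eq0 => /eqP e.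
by rewrite /Lagr e subr0.
Qed.

End WeakDuality.

Section DualMultipliers.
Context {R : realType} {n m q : nat}.
Variables (f : 'rV[R]_(n + m) -> R) (g : 'rV[R]_(n + m) -> 'rV[R]_q).
Hypotheses (f_C2 : C2 f) (g_C2 : forall i, C2 (fun z => g z 0 i)).
Implicit Types (x w : 'rV[R]_n) (y : 'rV[R]_m) (lam : 'rV[R]_q).

Definition fiber_convex x : Prop :=
  convex_function [set: 'rV[R]_m] (fun y => - f (row_mx x y)) /\
  forall i, convex_function [set: 'rV[R]_m] (fun y => g (row_mx x y) 0 i).

(** By weak duality the Lagrangian lies above the value function on the dual
    system, with equality at (x, y, lam), and the value function lies above a
    C1 function of x with gradient w.  So (x, y, lam) locally maximizes this C1
    function minus the Lagrangian over the dual system, and the constraint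
    qualification yields multipliers for the gradient of that difference. *)
Lemma regular_dual_multipliers x y lam w :
  (\forall x' \near x, fiber_convex x') ->
  solutions f g x y -> Sigma f g x y lam ->
  CQ (@dual_ineq R n m q) (dual_eq f g) (dual_pt x y lam) ->
  regular_subdiff (value f g) x w ->
  multipliers (fun _ : 'rV[R]_0 => @dual_ineq R n m q) (fun _ => dual_eq f g)
    (row_mx (row_mx (w - gradx_Lagr f g x y lam) 0) (g (row_mx x y)))
    0 (dual_pt x y lam) !=set0.
Proof.
move=> x_conv y_sol lam_mult cq /regular_subdiff_C1_minorant[h [h_C1 hx gradh h_near]].
have [stat [_ lam_ge0 _]] := lam_mult.
have val := value_eq_Lagr y_sol lam_mult.
pose psi x' := dot w x' - h x'.
pose phi (z : 'rV[R]_(n + m + q)) := psi (lsubmx (lsubmx z))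
  - Lagr f g (lsubmx (lsubmx z)) (rsubmx (lsubmx z)) (rsubmx z).
have psi_C1 : C1 psi by apply: C1D; [exact: C1_dot|exact: C1N].
have phi_C1 : C1 phi.
  apply: C1D; first exact: (C1_lsubmx q (C1_lsubmx m psi_C1)).
  by apply: C1N; exact: C1_Lagr_joint.
have phi_grad : grad phi (dual_pt x y lam)
    = row_mx (row_mx (w - gradx_Lagr f g x y lam) 0) (g (row_mx x y)).
  have hG := C1_has_gradient (dual_pt x y lam) phi_C1.
  rewrite -[LHS]hsubmxK; congr row_mx; first (rewrite -[LHS]hsubmxK; congr row_mx).
  - have := has_gradient_row_mxl (has_gradient_row_mxl hG).
    move=> /has_gradient_grad <-.
    rewrite (_ : (fun t => _) = fun t => psi t - Lagr f g t y lam); last first.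
      by apply/funext => t; rewrite /phi !(row_mxKl, row_mxKr).
    apply: has_gradient_grad; apply: has_gradientD.
      rewrite -[w]subr0 -gradh; apply: has_gradientD; first exact: has_gradient_dot.
      by apply: has_gradientN; exact: C1_has_gradient.
    by apply: has_gradientN; rewrite gradx_LagrE//; exact: has_gradient_Lagr_x.
  - have := has_gradient_row_mxr (has_gradient_row_mxl hG).
    move=> /has_gradient_grad <-.
    rewrite (_ : (fun t => _) = fun t => psi x - Lagr f g x t lam); last first.
      by apply/funext => t; rewrite /phi !(row_mxKl, row_mxKr).
    apply: has_gradient_grad; rewrite -[0]subr0 -{2}stat grady_LagrE//.
    apply: has_gradientD; first exact: has_gradient_cst.
    by apply: has_gradientN; exact: has_gradient_Lagr_y.
  - have := has_gradient_row_mxr hG.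
    move=> /has_gradient_grad <-.
    rewrite (_ : (fun t => _) = fun t => psi x - f (row_mx x y) + dot (g (row_mx x y)) t).
      apply: has_gradient_grad; rewrite -[g _]add0r.
      apply: has_gradientD; first exact: has_gradient_cst.
      by rewrite add0r; exact: has_gradient_dot.
    apply/funext => t; rewrite /phi !(row_mxKl, row_mxKr) /Lagr.
    by rewrite opprB addrA [in RHS]addrAC.
rewrite -phi_grad; apply: cq => //; split.
  split; last by rewrite /dual_eq /dual_pt !(row_mxKl, row_mxKr).
  by move=> i; rewrite /dual_ineq /dual_pt row_mxKr mxE oppr_le0.
have cont_x : lsubmx (lsubmx z) @[z --> dual_pt x y lam] --> x.
  rewrite [X in _ --> X](_ : x = lsubmx (lsubmx (dual_pt x y lam))).
    exact: continuous_comp (@continuous_lsubmx _ _ _ _ _) (@continuous_lsubmx R 1 n m _).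
  by rewrite /dual_pt !row_mxKl.
have near_x : \forall z \near dual_pt x y lam, fiber_convex (lsubmx (lsubmx z)) /\
    (value f g x + (dot w (lsubmx (lsubmx z) - x) - h (lsubmx (lsubmx z)))%:E
      <= value f g (lsubmx (lsubmx z)))%E.
  exact: cont_x (filterI x_conv h_near).
apply: filterS near_x => z [[f_conc g_conv] hz] [z_ineq z_eq].
have z_lam i : 0 <= rsubmx z 0 i by have := z_ineq i; rewrite mxE oppr_le0.
have := le_trans hz (weak_duality f_C2 g_C2 f_conc g_conv z_eq z_lam).
rewrite val -EFinD lee_fin /phi /psi /dual_pt !(row_mxKl, row_mxKr) hx dotDr dotNr.
by move=> h1; lra.
Qed.

End DualMultipliers.

(** * Limits of regular subgradients *)

Section Sequences.
Context {R : realType}.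

(** Only sigma k --> oo is asked of the extraction, since this is all that is needed to
    carry limits over; it spares the recursive choice of an increasing one. *)
Lemma compact_subseq d (Omega : set 'rV[R]_d) (y : nat -> 'rV[R]_d) :
  compact Omega -> (forall k, Omega (y k)) ->
  exists (ybar : 'rV[R]_d) (sigma : nat -> nat),
    sigma k @[k --> \oo] --> \oo /\ y (sigma k) @[k --> \oo] --> ybar.
Proof.
move=> cOmega Oy.
have [ybar [_ ybar_cluster]] : Omega `&` cluster (y k @[k --> \oo]) !=set0.
  by apply: cOmega; apply: (@nearW _ \oo) => k; exact: Oy.
have /choice[sigma hsigma] : forall k : nat, exists i : nat,
    (k <= i)%N /\ `|ybar - y i| < k.+1%:R^-1.
  move=> k.
  have tail : (y i @[i --> \oo]) [set z | exists2 i, (k <= i)%N & z = y i].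
    by exists k => // i /= ki; exists i.
  have [z [[i ki ->] yz]] := ybar_cluster _ _ tail
    (nbhsx_ballx ybar (k.+1%:R^-1) (ltac:(by rewrite invr_gt0))).
  by exists i; split => //; move: yz; rewrite -ball_normE.
exists ybar, sigma; split.
  by apply/cvgnyPge => A; exists A => // k /= Ak; apply: leq_trans (hsigma k).1.
apply/cvgrPdist_lt => e e0; near=> k.
apply: lt_trans (hsigma k).2 _.
by near: k; exact: near_infty_natSinv_lt (PosNum e0).
Unshelve. all: by end_near. Qed.

Lemma cvg_homo_nat (s : nat -> nat) :
  {homo s : i j / (i < j)%N} -> s k @[k --> \oo] --> \oo.
Proof.
move=> s_incr; apply/cvgnyPge => A; exists A => // k /= Ak.
suff : (k <= s k)%N by exact: leq_trans.
elim: k {Ak} => // k ih; exact: leq_ltn_trans ih (s_incr _ _ (ltnSn k)).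
Qed.

Lemma cvg_near_shift (T : topologicalType) (u : nat -> T) (l : T) (P : set T) :
  u k @[k --> \oo] --> l -> (\forall z \near l, P z) ->
  exists N, forall k, P (u (k + N)%N).
Proof.
move=> ul /ul[N _ hN]; exists N => k; apply: hN => /=; exact: leq_addl.
Qed.

Lemma cvg_row_mx (T : Type) (F : set_system T) {FF : Filter F} d e
    (u : T -> 'rV[R]_d) (v : T -> 'rV[R]_e) (u0 : 'rV[R]_d) (v0 : 'rV[R]_e) :
  u t @[t --> F] --> u0 -> v t @[t --> F] --> v0 ->
  row_mx (u t) (v t) @[t --> F] --> row_mx u0 v0.
Proof.
move=> hu hv; apply: cvg_rV => i; rewrite mxE.
under eq_cvg do rewrite mxE.
by case: (fintype.split i) => j; apply: cvg_coord.
Qed.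

Lemma cvg_lsubmx (T : Type) (F : set_system T) {FF : Filter F} d e
    (u : T -> 'rV[R]_(d + e)) (u0 : 'rV[R]_(d + e)) :
  u t @[t --> F] --> u0 -> lsubmx (u t) @[t --> F] --> lsubmx u0.
Proof. by move=> hu; exact: cvg_comp hu (@continuous_lsubmx _ _ _ _ u0). Qed.

Lemma cvg_rsubmx (T : Type) (F : set_system T) {FF : Filter F} d e
    (u : T -> 'rV[R]_(d + e)) (u0 : 'rV[R]_(d + e)) :
  u t @[t --> F] --> u0 -> rsubmx (u t) @[t --> F] --> rsubmx u0.
Proof. by move=> hu; exact: cvg_comp hu (@continuous_rsubmx _ _ _ _ u0). Qed.

Lemma complementaryC d (a b : 'rV[R]_d) : complementary a b -> complementary b a.
Proof. by case=> a0 b0 ab; split; rewrite // dotC. Qed.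

Lemma complementaryZ d t (a b : 'rV[R]_d) : 0 <= t ->
  complementary a b -> complementary (t *: a) b.
Proof.
move=> t0 [a0 b0 ab]; split; rewrite ?dotZl ?ab ?mulr0// => i.
by rewrite mxE mulr_ge0.
Qed.

(** Homogeneity of the KKT conditions, by which multiples t_k w_k tending to a singular
    subgradient are treated like the subgradients w_k themselves. *)
Lemma multipliersZ s d k l (G : 'rV[R]_s -> 'rV[R]_d -> 'rV[R]_k)
    (H : 'rV[R]_s -> 'rV[R]_d -> 'rV[R]_l) beta p z t : 0 <= t ->
  multipliers G H beta p z !=set0 -> multipliers G H (t *: beta) p z !=set0.
Proof.
move=> t0 [[a b] [/= eq_mult compl Hz]]; exists (t *: a, t *: b); split => //=.
  by rewrite -!scalemxAl -!scalerBr eq_mult scaler0.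
exact: complementaryZ.
Qed.

End Sequences.

Section LimitingStep.
Context {R : realType} {n m q : nat}.
Variables (f : 'rV[R]_(n + m) -> R) (g : 'rV[R]_(n + m) -> 'rV[R]_q).
Hypotheses (f_C2 : C2 f) (g_C2 : forall i, C2 (fun z => g z 0 i)).
Implicit Types (x w : 'rV[R]_n) (y : 'rV[R]_m) (lam : 'rV[R]_q).

Let f_C1 : C1 f. Proof. exact: f_C2.1. Qed.
Let g_C1 i : C1 (fun z => g z 0 i). Proof. exact: (g_C2 i).1. Qed.

Lemma g_continuous : continuous g.
Proof. by move=> z; apply: (@cvg_rV _ _ (nbhs z)) => i; exact: C1_continuous. Qed.

Lemma cvg_grad_Lagr (T : Type) (F : set_system T) {FF : Filter F}
    (z : T -> 'rV[R]_(n + m)) (lam : T -> 'rV[R]_q) (z0 : 'rV[R]_(n + m)) lam0 :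
  z t @[t --> F] --> z0 -> lam t @[t --> F] --> lam0 ->
  grad_Lagr f g (z t) (lam t) @[t --> F] --> grad_Lagr f g z0 lam0.
Proof.
move=> hz hlam; apply: cvgB; first exact: cvg_comp hz (f_C1.2 z0).
apply: (@cvg_sumr _ _ F FF _ _ (fun j t => lam t 0 j *: grad (fun u => g u 0 j) (z t))) => j.
apply: cvgZ; first exact: cvg_coord.
exact: cvg_comp hz ((g_C1 j).2 z0).
Qed.

Lemma grad_f_y x y :
  grad (fun t => f (row_mx x t)) y = rsubmx (grad f (row_mx x y)).
Proof.
by apply: has_gradient_grad; apply: has_gradient_row_mxr; exact: C1_has_gradient.
Qed.

Lemma C1_f_y x : C1 (fun t => f (row_mx x t)).
Proof.
rewrite (_ : (fun t => _) = fun t => f (row_mx x 0 + t *m row_mx 0 1%:M)).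
  exact: C1_affine.
by apply/funext => t; rewrite mul_mx_row mulmx1 mulmx0 add_row_mx add0r addr0.
Qed.

Lemma lower_multipliers_Sigma x y a b :
  multipliers (lower_ineq g) (@lower_eq R n m)
    (grad (fun t => f (row_mx x t)) y) x y (a, b) -> Sigma f g x y a.
Proof.
move=> [/= eq_mult compl _]; split; last exact: complementaryC.
rewrite grady_Lagr_affine// mulmxN -grad_f_y -[RHS]eq_mult.
by rewrite [b]thinmx0 mul0mx subr0.
Qed.

Lemma lower_CQ_multipliers x y : solutions f g x y ->
  CQ_at (lower_ineq g) (@lower_eq R n m) x y ->
  multipliers (lower_ineq g) (@lower_eq R n m)
    (grad (fun t => f (row_mx x t)) y) x y !=set0.
Proof.
move=> [y_feas y_val]; apply; first exact: C1_f_y.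
split; first by split.
apply: (@nearW _ (nbhs y)) => z [z_feas _]; rewrite -lee_fin y_val.
by apply: ereal_sup_ubound; exists z.
Qed.

Lemma solutions_closed (x : nat -> 'rV[R]_n) (y : nat -> 'rV[R]_m)
    (xbar : 'rV[R]_n) (ybar : 'rV[R]_m) :
  x k @[k --> \oo] --> xbar -> y k @[k --> \oo] --> ybar ->
  value f g (x k) @[k --> \oo] --> value f g xbar ->
  (forall k, solutions f g (x k) (y k)) -> solutions f g xbar ybar.
Proof.
move=> hx hy hV sol.
have hxy : row_mx (x k) (y k) @[k --> \oo] --> row_mx xbar ybar.
  exact: cvg_row_mx.
split.
  move=> i; have hg : g (row_mx (x k) (y k)) 0 i @[k --> \oo] --> g (row_mx xbar ybar) 0 i.
    by apply: cvg_coord; exact: cvg_comp hxy (@g_continuous _).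
  rewrite -(cvg_lim _ hg)//; apply: limr_le; first by apply/cvg_ex; exists (g (row_mx xbar ybar) 0 i).
  apply: nearW => k; exact: (sol k).1.
have hf : (f (row_mx (x k) (y k)))%:E @[k --> \oo] --> (f (row_mx xbar ybar))%:E.
  by apply: cvg_EFin; [exact: nearW|exact: cvg_comp hxy (@C1_continuous _ _ _ f_C1 _)].
rewrite (_ : (fun k => _) = fun k => value f g (x k)) in hf; last first.
  by apply/funext => k; rewrite (sol k).2.
exact: cvg_unique hf hV.
Qed.

End LimitingStep.

Section ValueSubdifferentialLimits.
Context {R : realType} {n m q : nat}.
Variables (f : 'rV[R]_(n + m) -> R) (g : 'rV[R]_(n + m) -> 'rV[R]_q).
Hypotheses (f_C2 : C2 f) (g_C2 : forall i, C2 (fun z => g z 0 i)).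
Variable xbar : 'rV[R]_n.

(** Limiting subgradients are the case t_k = 1 and r = 1, singular ones the case r = 0.
    Sup-compactness makes solutions y_k at x_k converge to a solution, the
    constraint qualification of the lower level problem makes multipliers lam_k
    at y_k converge, and that of the dual system makes the multipliers given by
    regular_dual_multipliers at (x_k, y_k, lam_k) converge; their limit is read
    off by dual_multipliers_Xi. *)
Lemma value_subdiff_limit (x w : nat -> 'rV[R]_n) (t : nat -> R) r v
    (Q : 'rV[R]_n -> 'rV[R]_m -> Prop) (Qd : 'rV[R]_(n + m + q) -> Prop) :
  (\forall x' \near xbar, fiber_convex f g x') ->
  restricted_sup_compact f g xbar ->
  stable_parametric_CQ (lower_ineq g) (@lower_eq R n m) Q ->
  (forall y, solutions f g xbar y -> Q xbar y) ->
  stable_CQ (@dual_ineq R n m q) (dual_eq f g) Qd ->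
  (forall y lam, solutions f g xbar y -> Sigma f g xbar y lam ->
     Qd (dual_pt xbar y lam)) ->
  x k @[k --> \oo] --> xbar ->
  value f g (x k) @[k --> \oo] --> value f g xbar ->
  (forall k, regular_subdiff (value f g) (x k) (w k)) ->
  (forall k, 0 < t k) -> t k @[k --> \oo] --> r ->
  t k *: w k @[k --> \oo] --> v ->
  exists y lam u,
    [/\ solutions f g xbar y, Sigma f g xbar y lam, Xi f g r xbar y lam u &
     v = r *: gradx_Lagr f g xbar y lam + u *m (hessxy_Lagr f g xbar y lam)^T].
Proof.
move=> conv_near [V_fin [eps [delta [W [eps0 delta0 cW hW]]]]].
move=> Q_stable Q_sol Qd_stable Qd_sol hx hV hw t0 ht htw.
(* Convexity is needed near each x_k, which follows from convexity near xbar as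
   the neighbourhoods of xbar contain open ones. *)
have [N hN] : exists N, forall k,
    (solutions f g (x (k + N)%N) `&` W !=set0) /\
    (\forall x' \near x (k + N)%N, fiber_convex f g x').
  have near_V : \forall z \near value f g xbar, (value f g xbar - eps%:E < z)%E.
    apply: open_ereal_gt'.
    by rewrite lteBlDr// lteDl// lte_fin.
  have near_x : \forall x' \near xbar, `|x' - xbar| < delta /\
      \forall x'' \near x', fiber_convex f g x''.
    have near_ball : \forall x' \near xbar, `|x' - xbar| < delta.
      by apply/nbhs_normP; exists delta => // x' /=; rewrite distrC.
    exact: filterI near_ball (nbhs_interior conv_near).
  have ev_x : \forall k \near \oo, `|x k - xbar| < delta /\
      \forall x'' \near x k, fiber_convex f g x'' := hx _ near_x.
  have ev_V : \forall k \near \oo,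
      (value f g xbar - eps%:E < value f g (x k))%E := hV _ near_V.
  have [N _ h] := filterI ev_x ev_V.
  exists N => k; have [/= [xd cx] Vx] := h (k + N)%N (leq_addl _ _).
  by split=> //; exact: hW.
have /choice[y0 hy0] : forall k, exists y,
    solutions f g (x (k + N)%N) y /\ W y by move=> k; have [[y yP] _] := hN k; exists y.
have [ybar [s1 [hs1 hy]]] := compact_subseq cW (fun k => (hy0 k).2).
pose i1 k := (s1 k + N)%N.
have hi1 : i1 k @[k --> \oo] --> \oo by exact: cvg_comp hs1 (cvg_addnr N).
pose y1 k := y0 (s1 k).
have y1_sol k : solutions f g (x (i1 k)) (y1 k) by exact: (hy0 (s1 k)).1.
have hx1 : x (i1 k) @[k --> \oo] --> xbar by exact: cvg_comp hi1 hx.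
have hV1 : value f g (x (i1 k)) @[k --> \oo] --> value f g xbar by exact: cvg_comp hi1 hV.
have ybar_sol : solutions f g xbar ybar by exact: solutions_closed hx1 hy hV1 y1_sol.
have feas_lower x' y : solutions f g x' y -> feasible (lower_ineq g) (@lower_eq R n m) x' y.
  by case.
(* Local persistence makes the qualification available at the points of the
   sequence, where it turns solutions into KKT points. *)
have [Q_near _ Q_seq] := Q_stable _ _ (feas_lower _ _ ybar_sol) (Q_sol _ ybar_sol).
have hxy1 : (x (i1 k), y1 k) @[k --> \oo] --> (xbar, ybar).
  exact: (cvg_pair hx1 hy).
have [N2 hN2] := cvg_near_shift hxy1 Q_near.
pose i2 k := i1 (k + N2)%N; pose y2 k := y1 (k + N2)%N.
have hi2 : i2 k @[k --> \oo] --> \oo by exact: cvg_comp (cvg_addnr N2) hi1.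
have hx2 : x (i2 k) @[k --> \oo] --> xbar by exact: cvg_comp hi2 hx.
have hy2 : y2 k @[k --> \oo] --> ybar by exact: cvg_comp (cvg_addnr N2) hy.
have y2_sol k : solutions f g (x (i2 k)) (y2 k) by exact: y1_sol.
have y2_mult k : multipliers (lower_ineq g) (@lower_eq R n m)
    (grad (fun y => f (row_mx (x (i2 k)) y)) (y2 k)) (x (i2 k)) (y2 k) !=set0.
  have Q2 := hN2 k (feas_lower _ _ (y2_sol k)).
  have [_ cq _] := Q_stable _ _ (feas_lower _ _ (y2_sol k)) Q2.
  exact: lower_CQ_multipliers.
have beta2 : grad (fun y => f (row_mx (x (i2 k)) y)) (y2 k) @[k --> \oo]
    --> grad (fun y => f (row_mx xbar y)) ybar.
  rewrite grad_f_y//; under eq_cvg do rewrite grad_f_y//.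
  apply: cvg_rsubmx; exact: cvg_comp (cvg_row_mx hx2 hy2) (f_C2.1.2 _).
have [lam [b [s2 [lambar [bbar [lam_mult hs2 hlam _ lambar_mult]]]]]] :=
  Q_seq _ _ _ _ beta2 hy2 hx2 y2_mult.
have lam_Sigma k := lower_multipliers_Sigma f_C2 g_C2 (lam_mult k).
have lambar_Sigma := lower_multipliers_Sigma f_C2 g_C2 lambar_mult.
pose i3 k := i2 (s2 k); pose y3 k := y2 (s2 k); pose lam3 k := lam (s2 k).
have hi3 : i3 k @[k --> \oo] --> \oo by exact: cvg_comp (cvg_homo_nat hs2) hi2.
have hx3 : x (i3 k) @[k --> \oo] --> xbar by exact: cvg_comp hi3 hx.
have hy3 : y3 k @[k --> \oo] --> ybar by exact: cvg_comp (cvg_homo_nat hs2) hy2.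
have hz3 : dual_pt (x (i3 k)) (y3 k) (lam3 k) @[k --> \oo] --> dual_pt xbar ybar lambar.
  by apply: cvg_row_mx => //; exact: cvg_row_mx.
have feas_dual x' y lam' : Sigma f g x' y lam' ->
    feasible (fun _ : 'rV[R]_0 => @dual_ineq R n m q) (fun _ => dual_eq f g) 0
      (dual_pt x' y lam').
  move=> [stat [_ lam_ge0 _]]; split; last by rewrite /dual_eq /dual_pt !(row_mxKl, row_mxKr).
  by move=> i; rewrite /dual_ineq /dual_pt row_mxKr mxE oppr_le0.
have [Qd_near _ Qd_seq] := Qd_stable 0 _ (feas_dual _ _ _ lambar_Sigma)
  (Qd_sol _ _ ybar_sol lambar_Sigma).
have hpz3 : ((0 : 'rV[R]_0), dual_pt (x (i3 k)) (y3 k) (lam3 k)) @[k --> \oo]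
    --> ((0 : 'rV[R]_0), dual_pt xbar ybar lambar).
  exact: (cvg_pair (cvg_cst _) hz3).
have [N4 hN4] := cvg_near_shift hpz3 Qd_near.
pose i4 k := i3 (k + N4)%N; pose y4 k := y3 (k + N4)%N; pose lam4 k := lam3 (k + N4)%N.
have hi4 : i4 k @[k --> \oo] --> \oo by exact: cvg_comp (cvg_addnr N4) hi3.
have hx4 : x (i4 k) @[k --> \oo] --> xbar by exact: cvg_comp hi4 hx.
have hy4 : y4 k @[k --> \oo] --> ybar by exact: cvg_comp (cvg_addnr N4) hy3.
have hlam4 : lam4 k @[k --> \oo] --> lambar by exact: cvg_comp (cvg_addnr N4) hlam.
have hz4 : dual_pt (x (i4 k)) (y4 k) (lam4 k) @[k --> \oo] --> dual_pt xbar ybar lambar.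
  exact: cvg_comp (cvg_addnr N4) hz3.
pose beta k : 'rV[R]_(n + m + q) := row_mx (row_mx (w (i4 k) - gradx_Lagr f g (x (i4 k)) (y4 k) (lam4 k)) 0)
  (g (row_mx (x (i4 k)) (y4 k))).
have mult4 k : multipliers (fun _ : 'rV[R]_0 => @dual_ineq R n m q) (fun _ => dual_eq f g)
    (t (i4 k) *: beta k) 0 (dual_pt (x (i4 k)) (y4 k) (lam4 k)) !=set0.
  apply: multipliersZ; first exact/ltW.
  have sig := lam_Sigma (s2 (k + N4)%N).
  apply: regular_dual_multipliers => //.
  - exact: (hN _).2.
  - exact: y2_sol.
  have [_ cq _] := Qd_stable 0 _ (feas_dual _ _ _ sig) (hN4 k (feas_dual _ _ _ sig)).
  exact: cq.
have hbeta : t (i4 k) *: beta k @[k --> \oo] -->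
    row_mx (row_mx (v - r *: gradx_Lagr f g xbar ybar lambar) 0)
      (r *: g (row_mx xbar ybar)).
  have ht4 : t (i4 k) @[k --> \oo] --> r by exact: cvg_comp hi4 ht.
  have hxy4 : row_mx (x (i4 k)) (y4 k) @[k --> \oo] --> row_mx xbar ybar.
    exact: cvg_row_mx.
  rewrite /beta; under eq_cvg do rewrite !scale_row_mx scaler0 scalerBr.
  apply: cvg_row_mx; last by apply: cvgZ => //; exact: cvg_comp hxy4 (@g_continuous _ _ _ _ _ g_C2 _).
  apply: cvg_row_mx; last exact: cvg_cst.
  apply: cvgB; first exact: cvg_comp hi4 htw.
  apply: cvgZ => //; rewrite gradx_LagrE//; under eq_cvg do rewrite gradx_LagrE//.
  by apply: cvg_lsubmx; exact: cvg_grad_Lagr.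
have [a [u [_ [abar [ubar [_ _ _ _ /(dual_multipliers_Xi f_C2 g_C2)[ev ubar_Xi]]]]]]] :=
  Qd_seq _ _ _ (fun=> 0) hbeta hz4 (cvg_cst _) mult4.
exists ybar, lambar, ubar; split => //.
by rewrite -ev addrCA subrr addr0.
Qed.

End ValueSubdifferentialLimits.

Theorem theorem3p3 (R : realType) (n m q : nat)
    (f : 'rV[R]_(n + m) -> R) (g : 'rV[R]_(n + m) -> 'rV[R]_q)
    (xbar : 'rV[R]_n) (ybar : 'rV[R]_m) (lambar : 'rV[R]_q)
    (f_C2 : C2 f)
    (g_C2 : forall i, C2 (fun z => g z 0 i))
    (f_concave : \forall x \near xbar,
       convex_function [set: 'rV[R]_m] (fun y => - f (row_mx x y)))
    (g_convex : forall i, \forall x \near xbar,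
       convex_function [set: 'rV[R]_m] (fun y => g (row_mx x y) 0 i))
    (ybar_sol : solutions f g xbar ybar)
    (lambar_mult : Sigma f g xbar ybar lambar)
    (dual_CQ : CQ (@dual_ineq R n m q) (dual_eq f g)
       (dual_pt xbar ybar lambar)) :
  regular_subdiff (value f g) xbar `<=`
    [set gradx_Lagr f g xbar ybar lambar
         + u *m (hessxy_Lagr f g xbar ybar lambar)^T
      | u in Xi f g 1 xbar ybar lambar]
  /\
  (restricted_sup_compact f g xbar ->
   (exists Q : 'rV[R]_n -> 'rV[R]_m -> Prop,
      stable_parametric_CQ (lower_ineq g) (@lower_eq R n m) Q /\
      forall y, solutions f g xbar y -> Q xbar y) ->
   (exists Q : 'rV[R]_(n + m + q) -> Prop,
      stable_CQ (@dual_ineq R n m q) (dual_eq f g) Q /\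
      forall y lam, solutions f g xbar y -> Sigma f g xbar y lam ->
        Q (dual_pt xbar y lam)) ->
   limiting_subdiff (value f g) xbar `<=`
     \bigcup_(y in solutions f g xbar) \bigcup_(lam in Sigma f g xbar y)
       [set gradx_Lagr f g xbar y lam + u *m (hessxy_Lagr f g xbar y lam)^T
         | u in Xi f g 1 xbar y lam]
   /\
   singular_subdiff (value f g) xbar `<=`
     \bigcup_(y in solutions f g xbar) \bigcup_(lam in Sigma f g xbar y)
       [set u *m (hessxy_Lagr f g xbar y lam)^T
         | u in Xi f g 0 xbar y lam]).
Proof.
have conv_near : \forall x \near xbar, fiber_convex f g x.
  have g_convex_all : \forall x \near xbar, forall i,
      convex_function [set: 'rV[R]_m] (fun y => g (row_mx x y) 0 i).
    exact: filter_forall g_convex.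
  exact: filterI f_concave g_convex_all.
split.
  move=> w w_reg.
  have [[a u]] := regular_dual_multipliers f_C2 g_C2 conv_near ybar_sol lambar_mult
    dual_CQ w_reg.
  rewrite -[g (row_mx _ _)]scale1r => /(dual_multipliers_Xi f_C2 g_C2)[ew u_Xi].
  by exists u => //; rewrite -ew addrC subrK.
move=> sup_compact [Q [Q_stable Q_sol]] [Qd [Qd_stable Qd_sol]]; split.
  move=> v [_ [x [w [hx hV hw hv]]]].
  have one_cvg : (1 : R) @[k --> \oo] --> (1 : R) by exact: cvg_cst.
  have one_hv : (1 : R) *: w k @[k --> \oo] --> v.
    by under eq_cvg do rewrite scale1r.
  have [y [lam [u [y_sol lam_Sigma u_Xi ->]]]] := value_subdiff_limit f_C2 g_C2
    conv_near sup_compact Q_stable Q_sol Qd_stable Qd_sol hx hV hw (fun=> ltr01)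
    one_cvg one_hv.
  by exists y => //; exists lam => //; exists u; rewrite ?scale1r.
move=> v [_ [x [w [t [hx hV hw [t0 ht] hv]]]]].
have [y [lam [u [y_sol lam_Sigma u_Xi ->]]]] := value_subdiff_limit f_C2 g_C2
  conv_near sup_compact Q_stable Q_sol Qd_stable Qd_sol hx hV hw t0 ht hv.
by exists y => //; exists lam => //; exists u => //; rewrite scale0r add0r.
Qed.
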